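(* Let $d\ge 2$ be an integer, assume $p=d$, and let $q=\frac{d}{d-1}$. Then, as $n\to\infty$, $$\mathrm{Cap}_{d,d}(n)\sim \frac{\mathrm{vol}_{d-1}(S_q^{d-1})}{(\log n)^{d-1}},$$ where $S_q^{d-1}=\{x\in\mathbb{R}^d:|x|_q=1\}$ and $\mathrm{vol}_{d-1}(S_q^{d-1})$ denotes the $(d-1)$-dimensional volume of $S_q^{d-1}$.
   Context: For $n\in\mathbb{N}$ let $D_n=\{x\in\mathbb{Z}^d: |x|_\infty\le n\}$, $\partial D_n=\{x\in\mathbb{Z}^d:|x|_\infty=n\}$, and let $E_n$ be the set of all (undirected) nearest-neighbour edges of the lattice $\mathbb{Z}^d$ with both endpoints in $D_n$. For $p\ge 1$ define the $p$-capacity between the origin and $\partial D_n$ in the graph $(D_n,E_n)$ by $$\mathrm{Cap}_{d,p}(n)=\inf\Big\{\sum_{\langle x,y\rangle\in E_n}|f(x)-f(y)|^p \ :\ f:D_n\to\mathbb{R},\ f(0)=0,\ f(x)\ge 1\ \text{for all }x\in\partial D_n\Big\},$$ where each undirected edge is counted once. $\mathrm{Cap}_{d,d}(n)$ is the case $p=d$. The norm is $|x|_q=(\sum_{i=1}^d|x_i|^q)^{1/q}$, and $a_n\sim b_n$ means $a_n/b_n\to1$ as $n\to\infty$.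
   Formalization: The (d-1)-dimensional volume of S_q^{d-1} is taken as Minkowski content with distances in |.|_q, equal to d times the volume of the unit ball of |.|_q; with ordinary Euclidean surface area the claim is false for every d ≥ 3 (for d = 2 both agree). *)

(* Defs.v *)
From HB Require Import structures.
From mathcomp Require Import all_boot all_order all_algebra.
From mathcomp Require Import all_classical all_reals all_analysis.

Set Implicit Arguments.
Unset Strict Implicit.
Unset Printing Implicit Defensive.

Import Order.TTheory GRing.Theory Num.Theory.
Import numFieldNormedType.Exports.

Local Open Scope classical_set_scope.
Local Open Scope ring_scope.

Section Capacity.
Variables (R : realType) (d : nat).

Definition supnorm (x : 'rV[int]_d) : nat := (\max_(i < d) `|x ord0 i|)%N.

Definition box (n : nat) : set 'rV[int]_d := [set x | (supnorm x <= n)%N].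

Definition box_boundary (n : nat) : set 'rV[int]_d := [set x | supnorm x = n].

(* Every undirected edge is listed once, oriented along its positive
   coordinate direction. *)
Definition edges (n : nat) : set ('rV[int]_d * 'rV[int]_d) :=
  [set e | [/\ box n e.1, box n e.2 &
     exists i : 'I_d, e.2 = e.1 + delta_mx ord0 i]].

Definition energy (p : R) (n : nat) (f : 'rV[int]_d -> R) : R :=
  \sum_(e \in edges n) `|f e.1 - f e.2| `^ p.

(* Potentials are total functions on Z^d, but only their values on [box n]
   enter the constraints and the energy. The set of energies is empty, and
   [inf] is a default value, only when n = 0. *)
Definition admissible (n : nat) : set ('rV[int]_d -> R) :=
  [set f | f 0 = 0 /\ forall x, box_boundary n x -> 1 <= f x].

Definition Cap (p : R) (n : nat) : R := inf (energy p n @` admissible n).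

End Capacity.

Arguments Cap {R} d%_N p n%_N.

Section Volume.
Variable R : realType.

(* d-dimensional Lebesgue measure: the d-fold product of the one-dimensional
   one, transported along (x, t) |-> x :: t. *)
Fixpoint lebesgue_tuple (d : nat) : set (d.-tuple R) -> \bar R :=
  if d is d'.+1 then fun A =>
    (@lebesgue_measure R \x @lebesgue_tuple d')%E
      [set xt : R * d'.-tuple R | A [tuple of xt.1 :: xt.2]]
  else fun A => \d_([tuple] : 0.-tuple R) A.

Variable d : nat.

Definition tuple_sub (x y : d.-tuple R) : d.-tuple R :=
  [tuple tnth x i - tnth y i | i < d].

Definition qnorm (q : R) (x : d.-tuple R) : R :=
  (\sum_(i < d) `|tnth x i| `^ q) `^ q^-1.

Definition qsphere (q : R) : set (d.-tuple R) := [set x | qnorm q x = 1].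

Definition qnbhd (q : R) (A : set (d.-tuple R)) (e : R) : set (d.-tuple R) :=
  [set x | exists2 a, A a & qnorm q (tuple_sub x a) <= e].

(* The (d-1)-dimensional volume of a hypersurface of (R^d, |.|_q), as its
   two-sided Minkowski content: half the growth rate at e = 0 of the Lebesgue
   measure of its closed e-neighbourhood, distances being measured by |.|_q.
   For q = 2 this is Euclidean area. For the unit sphere of |.|_q it is the
   constant s such that {x | |x|_q <= r} has measure s * r ^ d / d, that is,
   the mass of the sphere in polar coordinates; when q <> 2 and d >= 2 it
   differs from the Euclidean (Hausdorff) area of that sphere. *)
Definition surface_volume (q : R) (A : set (d.-tuple R)) : R :=
  fine (lim ((((2 * e)^-1)%:E * lebesgue_tuple (qnbhd q A e))%E @[e --> 0^'+])).

End Volume.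

Arguments qsphere {R} d%_N q _.

Definition asymp_equiv (R : realType) (a b : nat -> R) : Prop :=
  a n / b n @[n --> \oo] --> (1 : R).

(* Main.v *)
Require Import Defs.
From HB Require Import structures.
From mathcomp Require Import all_boot all_order all_algebra.
From mathcomp Require Import finmap.
From mathcomp Require Import all_classical all_reals all_analysis.
From mathcomp Require Import measurable_realfun ring lra zify.
Import Order.TTheory GRing.Theory Num.Theory.
Import numFieldNormedType.Exports.
Set Implicit Arguments.
Unset Strict Implicit.
Unset Printing Implicit Defensive.
Local Open Scope classical_set_scope.
Local Open Scope ring_scope.

(** Write p = d for the exponent and q for its conjugate, r = |x|_q, V for the
    volume of the unit q-ball and s = d V. In the continuum the minimiser is
    u / ln n with u = ln r: the gradient of r has unit p-norm, so the energy
    density of u is r^-d, whose integral over the shell of radii between 1 and n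
    is s ln n; dividing by (ln n)^d gives s / (ln n)^(d-1).

    Upper bound ([Cap_upper]). The restriction of u / ln n to the lattice is
    admissible. Along an edge only one coordinate changes, so the increments of u
    are estimated by the tangent inequality of t^q ([powR_tangent]), and their
    p-th powers add up at each point to r^-d, up to a factor tending to 1.

    Lower bound ([energy_lower]). The field theta = x / r^d is the flux of u,
    divergence free in the continuum, and its q-th powers also add up to r^-d.
    For an admissible f, Young's inequality on each edge ([young_edge]) reduces
    the claim to showing that theta pairs with the gradient of f to at least
    s - o(1). For f = u / ln n this follows from the same computation as above.
    The difference g of f and (truncated) u / ln n vanishes on the boundary of
    the box, so summation by parts ([edge_sum_parts]) turns its pairing with
    theta into the sum of g against the discrete divergence of theta. The latter
    is O(r^-(d+1)) ([divergence_near]), hence summable, and g tends to 0 near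
    the origin because a potential of small energy cannot move there.

    Lattice sums. Unit cubes compare the number of lattice points of a q-ball
    with its Lebesgue measure ([latcount_le], [latcount_ge]), which scales as
    the d-th power of the radius ([lebesgue_tuple_scale]); Abel summation then
    gives the sum of r^-d ([log_sum_le], [log_sum_ge]).

    Surface volume ([surface_volume_qsphere]). The e-neighbourhood of the sphere
    is the shell of radii between 1 - e and 1 + e, of measure
    V ((1 + e)^d - (1 - e)^d); half its growth rate at e = 0 is d V = s.

    From the lattice sums on, the dimension is written [d.+1]. *)

(** * Conjugate exponents and powers *)

Definition conj_exp (R : realType) (d : nat) : R := d%:R / (d%:R - 1).

Section ConjugateExponent.
Variables (R : realType) (d : nat).
Hypothesis hd : (2 <= d)%N.
Local Notation q := (conj_exp R d).

Lemma natr_ge2 : 2 <= d%:R :> R. Proof. by rewrite (ler_nat R 2). Qed.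

Lemma conj_exp_gt1 : 1 < q.
Proof. by have d2 := natr_ge2; rewrite /conj_exp ltr_pdivlMr; lra. Qed.

Lemma conj_exp_le2 : q <= 2.
Proof. by have d2 := natr_ge2; rewrite /conj_exp ler_pdivrMr; lra. Qed.

Lemma conj_expM : q * (d%:R - 1) = d%:R.
Proof. by have d2 := natr_ge2; rewrite /conj_exp divfK//; apply: lt0r_neq0; lra. Qed.

Lemma conj_expD : d%:R^-1 + q^-1 = 1.
Proof. by have d2 := natr_ge2; rewrite /conj_exp; field; apply/andP; split; apply: lt0r_neq0;
  lra. Qed.

End ConjugateExponent.

Section PowerInequalities.
Variable R : realType.
Implicit Types a b p q : R.

Lemma ler_powR_base p a b : 0 <= p -> 0 <= a -> a <= b -> a `^ p <= b `^ p.
Proof.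
by move=> p0 a0 ab; apply: ge0_ler_powR; rewrite ?nnegrE// (le_trans a0).
Qed.

(** Young's inequality for the pair [b] and [a `^ (q - 1)] is the tangent-line
    inequality of the convex function [t `^ q]. Being valid on both sides of [a]
    it also yields the upper estimate [powRB_le]. *)
Lemma powR_tangent q a b : 1 < q -> 0 <= a -> 0 <= b ->
  q * a `^ (q - 1) * (b - a) <= b `^ q - a `^ q.
Proof.
move=> q1 a0 b0.
have q0 : 0 < q by lra.
have q10 : 0 < q - 1 by lra.
have pq : q^-1 + (q / (q - 1))^-1 = 1.
  by field; apply/andP; split; apply: lt0r_neq0; lra.
have /= := conjugate_powR b0 (powR_ge0 a (q - 1)) q0 (divr_gt0 q0 q10) pq.
rewrite -powRrM (_ : (q - 1) * (q / (q - 1)) = q); last first.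
  by field; apply: lt0r_neq0.
move=> /(ler_wpM2l (ltW q0)).
rewrite (_ : q * (b `^ q / q + a `^ q / (q / (q - 1))) = b `^ q + (q - 1) * a `^ q); last first.
  by field; apply/andP; split; apply: lt0r_neq0; lra.
rewrite mulrBr -[q * _ * a]mulrA [_ * a]mulrC mulr_powRB1//; lra.
Qed.

Lemma powRB_le q a b : 1 < q -> 0 <= a -> 0 <= b ->
  b `^ q - a `^ q <= q * b `^ (q - 1) * (b - a).
Proof.
by move=> q1 a0 b0; have := powR_tangent q1 b0 a0; lra.
Qed.

Lemma powR_convex2 q (t a b : R) : 1 <= q -> 0 <= t <= 1 -> 0 <= a -> 0 <= b ->
  (t * a + (1 - t) * b) `^ q <= t * a `^ q + (1 - t) * b `^ q.
Proof.
move=> q1 /andP[t0 t1] a0 b0.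
have := @convex_powR R q q1 (Itv01 t0 t1) a b.
rewrite !inE/= !in_itv/= a0 b0 => /(_ isT isT).
by rewrite !convRE/=.
Qed.

Lemma exprnB_le (n : nat) a b : 0 <= a -> a <= b ->
  b ^+ n.+1 - a ^+ n.+1 <= n.+1%:R * b ^+ n * (b - a).
Proof.
move=> a0 ab; rewrite subrXX [X in _ <= X]mulrC ler_wpM2l ?subr_ge0//.
apply: le_trans (_ : \sum_(i < n.+1) b ^+ n <= _); last first.
  by rewrite sumr_const card_ord mulr_natl.
apply: ler_sum => i _; rewrite -[in leRHS](subnK (ltn_ord i : (i <= n)%N)).
by rewrite exprD ler_wpM2l ?exprn_ge0 ?(le_trans a0)// lerXn2r ?nnegrE// (le_trans a0).
Qed.

Lemma exprnB_ge (n : nat) a b : 0 <= a -> a <= b ->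
  n.+1%:R * a ^+ n * (b - a) <= b ^+ n.+1 - a ^+ n.+1.
Proof.
move=> a0 ab; rewrite subrXX [X in X <= _]mulrC ler_wpM2l ?subr_ge0//.
apply: le_trans (_ : \sum_(i < n.+1) a ^+ n <= _).
  by rewrite sumr_const card_ord mulr_natl.
apply: ler_sum => i _; rewrite -[in leLHS](subnK (ltn_ord i : (i <= n)%N)).
by rewrite exprD ler_wpM2r ?exprn_ge0// lerXn2r ?nnegrE// (le_trans a0).
Qed.

Lemma invXnB_le (n : nat) a b : 0 < a -> a <= b ->
  a ^- n.+1 - b ^- n.+1 <= n.+1%:R * (b - a) * a ^- n.+2.
Proof.
move=> a0 ab; have b0 := lt_le_trans a0 ab.
have -> : a ^- n.+1 - b ^- n.+1 = (b ^+ n.+1 - a ^+ n.+1) / (a ^+ n.+1 * b ^+ n.+1).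
  by field; rewrite !expf_neq0// lt0r_neq0.
rewrite ler_pdivrMr ?mulr_gt0 ?exprn_gt0//.
apply: le_trans (exprnB_le n (ltW a0) ab) _.
rewrite (_ : _ * _ * a ^- n.+2 * _ = n.+1%:R * (b - a) * (b ^+ n * (b / a))); last first.
  by rewrite !exprS; field; rewrite !lt0r_neq0 ?exprn_gt0.
rewrite mulrAC ler_wpM2l//.
  by rewrite mulr_ge0// subr_ge0.
by rewrite ler_peMr ?exprn_ge0 ?(ltW b0)// ler_pdivlMr// mul1r.
Qed.

Lemma invXnB_ge (n : nat) a b : 0 < a -> a <= b ->
  n.+1%:R * (b - a) * b ^- n.+2 <= a ^- n.+1 - b ^- n.+1.
Proof.
move=> a0 ab; have b0 := lt_le_trans a0 ab.
have -> : a ^- n.+1 - b ^- n.+1 = (b ^+ n.+1 - a ^+ n.+1) / (a ^+ n.+1 * b ^+ n.+1).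
  by field; rewrite !expf_neq0// lt0r_neq0.
rewrite ler_pdivlMr ?mulr_gt0 ?exprn_gt0//.
apply: le_trans _ (exprnB_ge n (ltW a0) ab).
rewrite (_ : _ * _ * b ^- n.+2 * _ = n.+1%:R * (b - a) * (a ^+ n * (a / b))); last first.
  by rewrite !exprS; field; rewrite !lt0r_neq0 ?exprn_gt0.
rewrite [leRHS]mulrAC ler_wpM2l ?mulr_ge0 ?subr_ge0//.
by rewrite ler_piMr ?exprn_ge0 ?(ltW a0)// ler_pdivrMr// mul1r.
Qed.

Lemma ln_subr_le a b : 0 < a -> 0 < b -> ln b - ln a <= (b - a) / a.
Proof.
move=> a0 b0; rewrite -ln_div ?posrE//.
rewrite (_ : b / a = 1 + (b - a) / a); last by field; exact: lt0r_neq0.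
apply: le_ln1Dx; rewrite mulrBl divff ?lt0r_neq0// ltrBrDr addrC subrr.
exact: divr_gt0.
Qed.

Lemma ln_subr_ge a b : 0 < a -> 0 < b -> (b - a) / b <= ln b - ln a.
Proof.
by move=> a0 b0; have := ln_subr_le b0 a0; rewrite -(opprB b a) mulNr; lra.
Qed.

Lemma powR_invK q a : q != 0 -> 0 <= a -> (a `^ q^-1) `^ q = a.
Proof. by move=> q0 a0; rewrite -powRrM mulVf// powRr1. Qed.

Lemma powRK_inv q a : q != 0 -> 0 <= a -> (a `^ q) `^ q^-1 = a.
Proof. by move=> q0 a0; rewrite -powRrM mulfV// powRr1. Qed.

End PowerInequalities.

(** * The q-norm *)

(** Locked: comparing the norms of two distinct points must not unfold the sum
    and the real powers. *)
HB.lock Definition lqnorm (R : realType) (d : nat) (q : R) (x : 'I_d -> R) : R :=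
  (\sum_(i < d) `|x i| `^ q) `^ q^-1.

Section LqNorm.
Variables (R : realType) (d : nat) (q : R).
Hypothesis q1 : 1 < q.
Implicit Types x y : 'I_d -> R.
Local Notation N := (lqnorm q).

Lemma gt1_gt0 : 0 < q. Proof. by move: q1; lra. Qed.
Lemma gt1_neq0 : q != 0. Proof. exact/lt0r_neq0/gt1_gt0. Qed.

Lemma lqnormE x : N x = (\sum_(i < d) `|x i| `^ q) `^ q^-1.
Proof. by rewrite unlock. Qed.

Lemma lqnorm_ge0 x : 0 <= N x. Proof. by rewrite lqnormE powR_ge0. Qed.

Lemma sum_powR_ge0 x : 0 <= \sum_(i < d) `|x i| `^ q.
Proof. by apply: sumr_ge0 => i _; exact: powR_ge0. Qed.

Lemma lqnorm_powR x : N x `^ q = \sum_(i < d) `|x i| `^ q.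
Proof. by rewrite lqnormE powR_invK ?gt1_neq0// sum_powR_ge0. Qed.

Lemma lqnorm_le x (c : R) : 0 <= c -> \sum_(i < d) `|x i| `^ q <= c `^ q -> N x <= c.
Proof.
move=> c0 h; rewrite lqnormE -(powRK_inv gt1_neq0 c0).
by apply: ler_powR_base => //; [rewrite invr_ge0 ltW// gt1_gt0|exact: sum_powR_ge0].
Qed.

Lemma lqnorm_ge x (c : R) : 0 <= c -> c `^ q <= \sum_(i < d) `|x i| `^ q -> c <= N x.
Proof.
move=> c0 h; rewrite lqnormE -(powRK_inv gt1_neq0 c0).
by apply: ler_powR_base => //; [rewrite invr_ge0 ltW// gt1_gt0|exact: powR_ge0].
Qed.

Lemma coord_le_lqnorm x i : `|x i| <= N x.
Proof.
apply: lqnorm_ge => //; rewrite (bigD1 i)//= ler_wpDr//.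
by apply: sumr_ge0 => j _; exact: powR_ge0.
Qed.

Lemma eq_lqnorm x y : (forall i, `|x i| = `|y i|) -> N x = N y.
Proof. by move=> xy; rewrite !lqnormE; under eq_bigr do rewrite xy. Qed.

Lemma le_lqnorm x y : (forall i, `|x i| <= `|y i|) -> N x <= N y.
Proof.
move=> xy; apply: lqnorm_le; rewrite ?lqnorm_ge0// lqnorm_powR.
by apply: ler_sum => i _; apply: ler_powR_base => //; exact/ltW/gt1_gt0.
Qed.

Lemma lqnormZ (c : R) x : N (fun i => c * x i) = `|c| * N x.
Proof.
rewrite !lqnormE; under eq_bigr do rewrite normrM powRM//.
rewrite -mulr_sumr powRM ?powR_ge0 ?sum_powR_ge0// powRK_inv//.
exact: gt1_neq0.
Qed.

Lemma lqnormN x : N (fun i => - x i) = N x.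
Proof. by apply: eq_lqnorm => i; rewrite normrN. Qed.

(** Minkowski's inequality. With a and b the norms of x and y, the vector of
    moduli divided by a + b is a convex combination of two unit vectors, and
    [t `^ q] is convex. *)
Lemma lqnormD x y : N (fun i => x i + y i) <= N x + N y.
Proof.
have q0 := ltW gt1_gt0.
have [x0|x0] := eqVneq (N x) 0.
  rewrite x0 add0r; apply: le_lqnorm => i.
  have : `|x i| <= 0 by rewrite -x0 coord_le_lqnorm.
  by rewrite normr_le0 => /eqP ->; rewrite add0r.
have [y0|y0] := eqVneq (N y) 0.
  rewrite y0 addr0; apply: le_lqnorm => i.
  have : `|y i| <= 0 by rewrite -y0 coord_le_lqnorm.
  by rewrite normr_le0 => /eqP ->; rewrite addr0.
have {}x0 : 0 < N x by rewrite lt0r x0 lqnorm_ge0.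
have {}y0 : 0 < N y by rewrite lt0r y0 lqnorm_ge0.
move: (erefl (N x)) (erefl (N y)) x0 y0.
move: {1 3 4}(N x) {1 3 4}(N y) => a b ax byy x0 y0.
have ab0 : 0 < a + b by rewrite addr_gt0.
apply: lqnorm_le; first exact: ltW.
pose t := a / (a + b).
have t01 : 0 <= t <= 1.
  by rewrite /t divr_ge0 ?(ltW x0) ?(ltW ab0)//= ler_pdivrMr// mul1r lerDl ltW.
apply: le_trans (_ : \sum_(i < d) (a + b) `^ q *
    (t * (`|x i| / a) `^ q + (1 - t) * (`|y i| / b) `^ q) <= _).
  apply: ler_sum => i _.
  apply: le_trans (ler_powR_base _ _ (ler_normD _ _)) _ => //.
  have -> : `|x i| + `|y i| = (a + b) * (t * (`|x i| / a) + (1 - t) * (`|y i| / b)).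
    by rewrite /t; field; rewrite !lt0r_neq0.
  case/andP: (t01) => t0 t1.
  rewrite powRM ?(ltW ab0)//; last first.
    by rewrite addr_ge0// mulr_ge0 ?subr_ge0// divr_ge0// ltW.
  rewrite ler_wpM2l ?powR_ge0//.
  by apply: powR_convex2; rewrite ?t0 ?t1 ?divr_ge0// ltW.
rewrite -mulr_sumr big_split/= -!mulr_sumr.
have E (z : 'I_d -> R) c : 0 < c -> c = N z ->
    \sum_(i < d) (`|z i| / c) `^ q = 1.
  move=> c0 cz; under eq_bigr do rewrite powRM ?invr_ge0 ?(ltW c0)//.
  rewrite -mulr_suml -lqnorm_powR -cz -powRM ?invr_ge0 ?(ltW c0)//.
  by rewrite divff ?lt0r_neq0// powR1.
by rewrite !E// !mulr1 subrKC mulr1.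
Qed.

Lemma lqnormB_ge x y : N x - N y <= N (fun i => x i - y i).
Proof.
rewrite lerBlDr; apply: le_trans (lqnormD _ _).
by apply: le_lqnorm => i; rewrite subrK.
Qed.

Lemma lqnorm_le_card x (M : R) : 0 <= M -> (forall i, `|x i| <= M) ->
  N x <= d%:R * M.
Proof.
move=> M0 xM; apply: lqnorm_le; first by rewrite mulr_ge0.
apply: le_trans (_ : \sum_(i < d) M `^ q <= _).
  by apply: ler_sum => i _; apply: ler_powR_base => //; exact/ltW/gt1_gt0.
rewrite sumr_const card_ord -[M `^ q *+ d]mulr_natl powRM// ler_wpM2r ?powR_ge0//.
have [->|d0] := posnP d; first exact: powR_ge0.
by apply: le1r_powR; rewrite ?ler1n// ltW.
Qed.

End LqNorm.

(** * Lebesgue measure on tuples *)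

Section LebesgueTuple.
Variable R : realType.
Local Notation mu := (@lebesgue_measure R).

Definition tuple_box d (I : 'I_d -> set R) : set (d.-tuple R) :=
  [set x | forall i, I i (tnth x i)].

Lemma measurable_tuple_box d (I : 'I_d -> set R) :
  (forall i, measurable (I i)) -> measurable (tuple_box I).
Proof.
move=> mI.
have -> : tuple_box I = \bigcap_(i in [set: 'I_d]) ((@tnth _ R ^~ i) @^-1` I i).
  by apply/seteqP; split=> [x h i _|x h i]; exact: h.
apply: fin_bigcap_measurable => // i _.
by rewrite -[X in measurable X]setTI; apply: measurable_tnth.
Qed.

Lemma measurable_cons_pair d :
  measurable_fun [set: R * d.-tuple R] (fun xt => [tuple of xt.1 :: xt.2]).
Proof. exact: measurable_cons. Qed.

Lemma bigcup_centered_cubes d :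
  \bigcup_n @tuple_box d (fun=> `[- n%:R, n%:R]%classic) = [set: d.-tuple R].
Proof.
apply/seteqP; split => // x _.
have s0 : 0 <= \sum_(i < d) `|tnth x i| by rewrite sumr_ge0.
exists (Num.bound (\sum_(i < d) `|tnth x i|)) => // i /=.
rewrite in_itv/= -ler_norml; apply/ltW/(le_lt_trans _ (archi_boundP s0)).
by rewrite (bigD1 i)//= lerDl sumr_ge0.
Qed.

Let sigma_finite_measure_of d (m : {measure set (d.-tuple R) ->
  \bar R}) (sf : sigma_finite setT m) :
  {sigma_finite_measure set (d.-tuple R) -> \bar R}.
Proof.
pose H1 := isSFinite.Build _ _ _ _ (sfinite_measure_sigma_finite sf).
pose H2 := isSigmaFinite.Build _ _ _ _ sf.
exact: (HB.pack_for (SigmaFiniteMeasure.type (d.-tuple R) R) (Measure.sort m) H1 H2).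
Defined.

(** A product with a set function is a measure when the second factor is a
    sigma-finite measure. The induction on the dimension therefore carries a
    bundled measure, and its values on cubes provide the sigma-finiteness that
    the next step consumes. *)
Lemma lebesgue_tuple_spec d :
  exists2 m : {sigma_finite_measure set (d.-tuple R) -> \bar R},
    (m : set _ -> \bar R) = @lebesgue_tuple R d &
  (forall (I : 'I_d -> set R) (c : R), (forall i, measurable (I i)) ->
    (forall i, mu (I i) = c%:E) -> m (tuple_box I) = (c ^+ d)%:E).
Proof.
elim: d => [|d [m mE IH]].
  exists \d_([tuple] : 0.-tuple R) => // I c _ _ /=.
  by rewrite expr0 diracE mem_set//; case.
have boxE (I : 'I_d.+1 -> set R) (c : R) : (forall i, measurable (I i)) ->
    (forall i, mu (I i) = c%:E) -> @lebesgue_tuple R d.+1 (tuple_box I) = (c ^+ d.+1)%:E.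
  move=> mI cI.
  have -> : @lebesgue_tuple R d.+1 (tuple_box I) =
      (mu \x m)%E (I ord0 `*` tuple_box (fun i => I (lift ord0 i))).
    rewrite mE /=; congr (product_measure1 _ _ _).
    apply/seteqP; split => -[x t]/=.
      move=> h; split; first exact: (h ord0).
      by move=> i; have := h (lift ord0 i); rewrite tnthS.
    move=> [h0 h] i; case: (unliftP ord0 i) => [j ->|->//].
    by rewrite tnthS; exact: h.
  rewrite product_measure1E; [|exact: (mI ord0)|exact: measurable_tuple_box].
  by rewrite (IH _ c)// [X in (X * _)%E](cI ord0) -EFinM exprS.
pose f := fun xt : R * d.-tuple R => [tuple of xt.1 :: xt.2].
have mf : measurable_fun setT f by exact: measurable_cons_pair.
have PE : pushforward (mu \x m)%E f = @lebesgue_tuple R d.+1.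
  by apply/funext => A; rewrite /pushforward mE.
pose P : {measure set (d.+1.-tuple R) -> \bar R} :=
  measure_function_pushforward__canonical__measure_function_Measure (mu \x m)%E mf.
have PE' : (P : set _ -> \bar R) = @lebesgue_tuple R d.+1 by rewrite -PE.
have sf : sigma_finite setT P.
  exists (fun n => @tuple_box d.+1 (fun=> `[- n%:R, n%:R]%classic)).
    by rewrite bigcup_centered_cubes.
  move=> n; split; first by apply: measurable_tuple_box => i; exact: measurable_itv.
  rewrite PE' (boxE _ (n%:R + n%:R)) ?ltry// => _.
  rewrite lebesgue_measure_itv/= lte_fin.
  by case: ltP => [_|]; rewrite ?opprK//; case: n => [|n]; rewrite ?addr0//;
    rewrite leNgt gtrN// ltr0n.
exists (sigma_finite_measure_of sf); first exact: PE'.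
by move=> I c mI cI; rewrite -(boxE I c mI cI) -PE'.
Qed.

Lemma lebesgue_tuple_box d (I : 'I_d -> set R) (c : R) :
  (forall i, measurable (I i)) -> (forall i, mu (I i) = c%:E) ->
  lebesgue_tuple (tuple_box I) = (c ^+ d)%:E.
Proof. by have [m <-] := lebesgue_tuple_spec d; exact. Qed.

Let leb0 d : lebesgue_tuple (set0 : set (d.-tuple R)) = 0%E.
Proof. by have [m <- _] := lebesgue_tuple_spec d. Qed.

Let leb_ge0 d (A : set (d.-tuple R)) : (0 <= lebesgue_tuple A)%E.
Proof. by have [m <- _] := lebesgue_tuple_spec d. Qed.

Let leb_sigma_additive d : semi_sigma_additive (@lebesgue_tuple R d).
Proof.
have [m <- _] := lebesgue_tuple_spec d; exact: measure_semi_sigma_additive.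
Qed.

HB.instance Definition _ d := isMeasure.Build _ _ _ (@lebesgue_tuple R d)
  (leb0 d) (@leb_ge0 d) (@leb_sigma_additive d).

Let leb_sigma_finite d : sigma_finite setT (@lebesgue_tuple R d).
Proof.
have [m <- _] := lebesgue_tuple_spec d; exact: sigma_finiteT.
Qed.

HB.instance Definition _ d := Measure_isSigmaFinite.Build _ _ _
  (@lebesgue_tuple R d) (@leb_sigma_finite d).

End LebesgueTuple.

Lemma finite_box (d n : nat) : finite_set (@box d n).
Proof.
pose f (g : {ffun 'I_d -> 'I_(n + n).+1}) : 'rV[int]_d :=
  \row_i ((g i : nat)%:Z - n%:Z).
apply: (@sub_finite_set _ _ (f @` setT)); last exact/finite_image/finite_finset.
move=> k /= kn.
have h i : (`|k ord0 i|%N <= n)%N by apply: leq_trans kn; exact: leq_bigmax.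
exists [ffun i => inord (absz (k ord0 i + n%:Z)%R)] => //.
apply/rowP => i; rewrite mxE ffunE; have := h i.
by move: (k ord0 i) => z zn; rewrite inordK; lia.
Qed.

(** * Scaling and the volume of q-balls *)

Section Scaling.
Variable R : realType.
Local Notation mu := (@lebesgue_measure R).

Let mulr_measurable (r : R) :
  measurable_fun [set: measurableTypeR R] (fun x : measurableTypeR R => r * x :
    measurableTypeR R).
Proof. exact: mulrl_measurable. Qed.

(** Both sides are measures agreeing on half-open intervals. *)
Lemma lebesgue_measure_scale (r : R) (A : set R) : 0 < r -> measurable A ->
  mu A = (r%:E * mu ((fun x => r * x)%R @^-1` A))%E.
Proof.
move=> r0 mA.
pose nu : {measure set (measurableTypeR R) -> \bar R} :=
  mscale (NngNum (ltW r0))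
    (measure_function_pushforward__canonical__measure_function_Measure mu
      (mulr_measurable r)).
rewrite (_ : (_ * _)%E = nu A)//.
apply: lebesgue_measure_unique => // _ [[a b]] _ <-.
rewrite /nu/= /mscale/= /pushforward/=.
rewrite (_ : (fun x => r * x) @^-1` `]a, b] = `]a / r, b / r]%classic); last first.
  apply/seteqP; split => x/=; rewrite !in_itv/= ltr_pdivrMr// ler_pdivlMr//;
    by rewrite [r * x]mulrC.
rewrite !lebesgue_measure_itv/= !lte_fin ltr_pM2r ?invr_gt0//.
case: ifPn => _; last by rewrite mule0.
by rewrite -!EFinB -EFinM; congr EFin; field; exact: lt0r_neq0.
Qed.

Lemma ge0_integral_scale (r : R) (g : R -> \bar R) : 0 < r ->
  measurable_fun [set: R] g -> (forall x, 0 <= g x)%E ->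
  (\int[mu]_x g x = r%:E * \int[mu]_x g (r * x)%R)%E.
Proof.
move=> r0 mg g0.
pose nu : {measure set (measurableTypeR R) -> \bar R} :=
    (measure_function_pushforward__canonical__measure_function_Measure mu
      (mulr_measurable r)).
transitivity (\int[mscale (NngNum (ltW r0)) nu]_x g x)%E.
  by apply: eq_measure_integral => A mA _; exact: lebesgue_measure_scale.
rewrite ge0_integral_mscale//; congr (_ * _)%E.
by rewrite ge0_integral_pushforward.
Qed.

Definition tuple_scale d (r : R) (x : d.-tuple R) : d.-tuple R :=
  [tuple r * tnth x i | i < d].

Lemma measurable_tuple_scale d (r : R) :
  measurable_fun [set: d.-tuple R] (@tuple_scale d r).
Proof.
apply/measurable_fun_tnthP => i.
rewrite (_ : _ \o _ = (fun x : d.-tuple R => r * tnth x i)).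
  by apply: measurable_funM; [exact: measurable_cst|exact: measurable_tnth].
by apply/funext => x/=; rewrite tnth_mktuple.
Qed.

Lemma tuple_scale_cons d (r : R) (a : R) (x : d.-tuple R) :
  tuple_scale r [tuple of a :: x] = [tuple of r * a :: tuple_scale r x].
Proof.
apply: eq_from_tnth => i; rewrite tnth_mktuple.
by case: (unliftP ord0 i) => [j ->|->//]; rewrite !tnthS tnth_mktuple.
Qed.

(** Induction on the dimension: the sections of the preimage of A are the
    preimages of the sections of A, taken at the scaled abscissa, so Tonelli
    leaves one factor r for the remaining coordinate. *)
Lemma lebesgue_tuple_scale d (r : R) (A : set (d.-tuple R)) : 0 < r ->
  measurable A ->
  lebesgue_tuple A = ((r ^+ d)%:E * lebesgue_tuple (tuple_scale r @^-1` A))%E.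
Proof.
move=> r0; elim: d => [|d IH] in A *.
  move=> _; rewrite expr0 mul1e; congr (lebesgue_tuple _).
  by apply/seteqP; split => x /=; rewrite [x]tuple0 [tuple_scale _ _]tuple0.
move=> mA /=.
pose A' := [set xt : R * d.-tuple R | A [tuple of xt.1 :: xt.2]].
have mA' : measurable A'.
  by rewrite -[A']setTI; exact: (@measurable_cons_pair R d).
have mB : measurable [set xt : R * d.-tuple R | (tuple_scale r @^-1` A) [tuple of xt.1 ::
  xt.2]].
  rewrite -[X in measurable X]setTI; apply: (@measurable_cons_pair R d) => //.
  by rewrite -[X in measurable X]setTI; apply: measurable_tuple_scale.
have mxs x : measurable (xsection A' x) by exact: measurable_xsection.
rewrite /product_measure1 (@ge0_integral_scale r)//; last first.
  exact: measurable_fun_xsection.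
rewrite exprSr EFinM -muleA [in RHS]muleCA; congr (_ * _)%E.
rewrite -ge0_integralZl//; last 2 first.
- exact: measurable_fun_xsection.
- by rewrite lee_fin exprn_ge0// ltW.
apply: eq_integral => x _ /=.
rewrite (IH (xsection A' (r * x)))//; congr (_ * lebesgue_tuple _)%E.
apply/seteqP; split => t; rewrite /xsection/= !inE/= tuple_scale_cons//.
Qed.

Section Ball.
Variables (d : nat) (q : R).
Hypothesis q1 : 1 < q.
Local Notation N x := (lqnorm q (tnth x)).
Local Notation leb := (@lebesgue_tuple R d).

Lemma qnormE (x : d.-tuple R) : qnorm q x = N x. Proof. by rewrite lqnormE. Qed.

Definition qball (r : R) : set (d.-tuple R) := [set x | N x <= r].

Lemma measurable_lqnorm : measurable_fun [set: d.-tuple R] (fun x => N x).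
Proof.
under eq_fun do rewrite lqnormE.
apply: (measurableT_comp (measurable_powR _)) => //.
apply: measurable_sum => i; apply: (measurableT_comp (measurable_powR _)) => //.
by apply: measurableT_comp => //; exact: measurable_tnth.
Qed.

Lemma measurable_qball r : measurable (qball r).
Proof.
rewrite (_ : qball r = (fun x => N x) @^-1` `]-oo, r]).
  by rewrite -[X in measurable X]setTI; apply: measurable_lqnorm.
by apply/seteqP; split => x/=; rewrite /qball/= in_itv.
Qed.

Lemma le_qball r s : r <= s -> qball r `<=` qball s.
Proof. by move=> rs x /=; rewrite /qball/= => /le_trans; apply. Qed.

Lemma lebesgue_qball r : 0 < r -> leb (qball r) = ((r ^+ d)%:E * leb (qball 1))%E.
Proof.
move=> r0; rewrite (lebesgue_tuple_scale r0); last exact: measurable_qball.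
congr (_ * leb _)%E; apply/seteqP.
suff h (x : d.-tuple R) : N (tuple_scale r x) <= r <-> N x <= 1.
  by split => x; rewrite /qball/= h.
have -> : N (tuple_scale r x) = r * N x.
  transitivity (lqnorm q (fun i => r * tnth x i)).
    by apply: eq_lqnorm => i; rewrite tnth_mktuple.
  by rewrite (lqnormZ q1) gtr0_norm.
by rewrite -ler_pdivlMl// mulVf// lt0r_neq0.
Qed.

(** * Lattice points in q-balls *)

Definition latnorm (k : 'rV[int]_d) : R := lqnorm q (fun i => (k ord0 i)%:~R).

Definition latball (r : R) : set 'rV[int]_d := [set k | latnorm k <= r].

(** Half-open cubes tile the space: x lies in the cube of its coordinatewise
    floor and in no other. *)
Definition cube (k : 'rV[int]_d) : set (d.-tuple R) :=
  tuple_box (fun i => `[(k ord0 i)%:~R, (k ord0 i + 1)%:~R[%classic).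

Lemma measurable_cube k : measurable (cube k).
Proof. by apply: measurable_tuple_box => i; exact: measurable_itv. Qed.

Lemma lebesgue_cube k : leb (cube k) = 1%E.
Proof.
have mI i : measurable (`[(k ord0 i)%:~R, (k ord0 i + 1)%:~R[%classic : set R).
  exact: measurable_itv.
rewrite (lebesgue_tuple_box mI (c := 1)) ?expr1n// => i.
by rewrite lebesgue_measure_itv/= lte_fin ltr_int ltrDl ltr01 -EFinB rmorphD/= addrAC subrr
  add0r.
Qed.

Lemma cubeP k x : cube k x <-> forall i, Num.floor (tnth x i) = k ord0 i.
Proof.
split => h i; first by apply: floor_def; have := h i; rewrite /= in_itv.
by rewrite /= in_itv/= -(h i) floor_itv.
Qed.

Lemma trivIset_cube (D : set 'rV[int]_d) : trivIset D cube.
Proof.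
move=> k l _ _ [x [/cubeP kx /cubeP lx]].
by apply/rowP => i; rewrite -kx -lx.
Qed.

Lemma lqnorm_cube k x : cube k x ->
  lqnorm q (fun i => tnth x i - (k ord0 i)%:~R) <= d%:R.
Proof.
move=> kx; rewrite -[leRHS]mulr1; apply: lqnorm_le_card => // i.
have := kx i; rewrite /= in_itv/= rmorphD/= => /andP[h1 h2].
by rewrite ger0_norm ?subr_ge0// lerBlDr addrC ltW.
Qed.

Lemma coord_le_latnorm (k : 'rV[int]_d) i : `|k ord0 i|%:~R <= latnorm k.
Proof.
by have := coord_le_lqnorm q1 (fun i => (k ord0 i)%:~R : R) i; rewrite -intr_norm.
Qed.

Lemma supnorm_le_latnorm k : (supnorm k)%:R <= latnorm k.
Proof.
rewrite /supnorm; apply: (big_ind (fun m : nat => m%:R <= latnorm k)) => [|a b ha hb|i _];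
  first exact: lqnorm_ge0.
  by rewrite /maxn; case: ifP.
by have := coord_le_latnorm k i; rewrite -abszE.
Qed.

Lemma latnorm_le_supnorm k : latnorm k <= d%:R * (supnorm k)%:R.
Proof.
apply: lqnorm_le_card => // i; rewrite -intr_norm -abszE.
by rewrite ler_nat (leq_bigmax i).
Qed.

Lemma finite_latball r : finite_set (latball r).
Proof.
have [r0|r0] := leP 0 r; last first.
  rewrite (_ : latball r = set0)//; apply/seteqP; split => // k.
  by rewrite /latball/= leNgt (lt_le_trans r0)// lqnorm_ge0.
apply: sub_finite_set (finite_box d (Num.bound r)) => k /= kr.
rewrite /box/= -(ler_nat R); apply: le_trans (supnorm_le_latnorm k) _.
exact: le_trans kr (ltW (archi_boundP r0)).
Qed.

Definition latcount (r : R) : nat := size (fset_set (latball r)).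

Lemma lebesgue_latball r :
  leb (\bigcup_(k in latball r) cube k) = (latcount r)%:R%:E.
Proof.
rewrite measure_fin_bigcup//; [|exact: finite_latball|exact: trivIset_cube|by move=> k _;
  exact: measurable_cube].
rewrite (eq_fsbigr (fun=> 1%E)); last by move=> k _; exact: lebesgue_cube.
rewrite fsbig_finite/=; last exact: finite_latball.
by rewrite sumEFin big_const_seq count_predT iter_addr addr0.
Qed.

Lemma measurable_latball r : measurable (\bigcup_(k in latball r) cube k).
Proof.
by apply: fin_bigcup_measurable => [|k _]; [exact: finite_latball|exact: measurable_cube].
Qed.

(** The unit cubes attached to the lattice points of a ball are disjoint, have
    measure 1 and q-diameter at most d; hence they fit into the ball of radius
    [r + d]. Conversely they cover the ball of radius [r - d], which is
    [latcount_ge]. *)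
Lemma latcount_le r : ((latcount r)%:R%:E <= leb (qball (r + d%:R)))%E.
Proof.
rewrite -lebesgue_latball; apply: le_measure; rewrite ?inE.
- exact: measurable_latball.
- exact: measurable_qball.
move=> x [k kr kx]; rewrite /qball/=.
rewrite addrC -lerBlDr; apply: le_trans (lqnorm_cube kx).
by apply: le_trans (lqnormB_ge q1 _ _); rewrite lerD2l lerN2.
Qed.

Lemma latcount_ge r : (leb (qball r) <= (latcount (r + d%:R))%:R%:E)%E.
Proof.
rewrite -lebesgue_latball; apply: le_measure; rewrite ?inE.
- exact: measurable_qball.
- exact: measurable_latball.
move=> x xr; exists (\row_i Num.floor (tnth x i)); last first.
  by apply/cubeP => i; rewrite mxE.
have kx : cube (\row_i Num.floor (tnth x i)) x by apply/cubeP => i; rewrite mxE.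
have := lqnorm_cube kx; rewrite -lqnormN => h.
rewrite /latball/= addrC -lerBlDr; apply: le_trans h.
rewrite [leRHS](_ : _ = lqnorm q (fun i =>
    ((\row_i Num.floor (tnth x i)) ord0 i)%:~R - tnth x i)); last first.
  by apply: eq_lqnorm => i; rewrite opprB.
by apply: le_trans (lqnormB_ge q1 _ _); rewrite lerD2l lerN2.
Qed.

Definition qball_vol : R := fine (leb (qball 1)).
Local Notation V := qball_vol.

(** The unit ball is covered by finitely many unit cubes. *)
Lemma qball_volE : leb (qball 1) = V%:E.
Proof.
rewrite fineK// ge0_fin_numE ?measure_ge0//.
exact: le_lt_trans (latcount_ge 1) (ltry _).
Qed.

Lemma lebesgue_qballE r : 0 < r -> leb (qball r) = (V * r ^+ d)%:E.
Proof. by move=> r0; rewrite lebesgue_qball// qball_volE -EFinM mulrC. Qed.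

Lemma latcount_leV r : 0 <= r -> (0 < d)%N -> (latcount r)%:R <= V * (r + d%:R) ^+ d.
Proof.
move=> r0 d0; rewrite -lee_fin -lebesgue_qballE ?latcount_le//.
by rewrite ltr_wpDl// ltr0n.
Qed.

Lemma latcount_geV r : 0 < r -> V * r ^+ d <= (latcount (r + d%:R))%:R.
Proof. by move=> r0; rewrite -lee_fin -lebesgue_qballE ?latcount_ge. Qed.

Lemma qball_vol_gt0 : (0 < d)%N -> 0 < V.
Proof.
move=> d0; have := latcount_leV (lexx 0) d0.
rewrite add0r => h; have dd : 0 < (d%:R : R) ^+ d by rewrite exprn_gt0// ltr0n.
rewrite -(pmulr_lgt0 _ dd); apply: lt_le_trans h.
rewrite ltr0n /latcount -has_predT; apply/hasP; exists 0 => //.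
rewrite in_fset_set; last exact: finite_latball.
rewrite inE /latball/= /latnorm.
by apply: lqnorm_le => //; rewrite big1 ?powR_ge0// => i _; rewrite mxE normr0 powR0// gt1_neq0.
Qed.

(** * Shells around the unit q-sphere *)

Lemma lqnorm_unit_diff (x : d.-tuple R) : 0 < N x ->
  lqnorm q (fun i => tnth x i - tnth (tuple_scale (N x)^-1 x) i) = `|N x - 1|.
Proof.
move=> x0; transitivity (lqnorm q (fun i => (1 - (N x)^-1) * tnth x i)).
  by apply: eq_lqnorm => i; rewrite tnth_mktuple mulrBl mul1r.
rewrite (lqnormZ q1) -[X in _ * X](gtr0_norm x0) -normrM mulrBl mul1r mulVf//.
exact: lt0r_neq0.
Qed.

Definition qshell (e : R) : set (d.-tuple R) := [set x | `|N x - 1| <= e].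

(** One inclusion is the triangle inequality. For the other one, the radial
    projection of x on the sphere is at distance [`|N x - 1|] from x. *)
Lemma qnbhd_qsphere e : 0 < e -> e < 1 ->
  qnbhd q (qsphere d q) e = (qshell e).
Proof.
move=> e0 e1; apply/seteqP; split => x /=.
  case=> a a1; rewrite (_ : qnorm _ _ = lqnorm q (fun i => tnth x i - tnth a i)); last first.
    by rewrite qnormE; apply: eq_lqnorm => i; rewrite tnth_mktuple.
  have {}a1 : N a = 1 by rewrite -qnormE.
  rewrite /qshell/= -[X in _ -> `|_ - X| <= _]a1; apply: le_trans;
    rewrite ler_norml (lqnormB_ge q1) andbT.
  rewrite lerNl opprB; apply: le_trans (lqnormB_ge q1 _ _) _.
  by rewrite -lqnormN; apply: le_lqnorm => // i; rewrite opprB.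
rewrite /qshell/= => xe.
have x0 : 0 < N x by move: xe; move: (N x) => y; rewrite ler_norml; lra.
exists (tuple_scale (N x)^-1 x).
  rewrite /qsphere/= qnormE; transitivity (lqnorm q (fun i => (N x)^-1 * tnth x i)).
    by apply: eq_lqnorm => i; rewrite tnth_mktuple.
  rewrite (lqnormZ q1) gtr0_norm ?invr_gt0// mulVf//; exact: lt0r_neq0.
apply: le_trans xe; rewrite -(lqnorm_unit_diff x0) qnormE.
by apply: le_lqnorm => // i; rewrite !tnth_mktuple.
Qed.

Lemma measurable_qshell e : measurable (qshell e).
Proof.
rewrite (_ : qshell e = (fun x => N x) @^-1` `[1 - e, 1 + e]).
  by rewrite -[X in measurable X]setTI; apply: measurable_lqnorm.
by apply/seteqP; split => x/=; rewrite /qshell/= ler_norml in_itv/=; lra.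
Qed.

Lemma lebesgue_qballD r s : 0 < r -> r <= s ->
  leb (qball s `\` qball r) = (V * (s ^+ d - r ^+ d))%:E.
Proof.
move=> r0 rs; have s0 := lt_le_trans r0 rs.
rewrite measureD; [|exact: measurable_qball..|].
  rewrite (setIidr (le_qball rs)) [X in (X - _)%E]lebesgue_qballE//.
  by rewrite [X in (_ - X)%E]lebesgue_qballE// -EFinB mulrBr.
by rewrite [X in (X < _)%E]lebesgue_qballE// ltry.
Qed.

Lemma lebesgue_qshell_ge e : 0 < e -> e < 1 ->
  ((V * ((1 + e) ^+ d - (1 - e) ^+ d))%:E <= leb (qshell e))%E.
Proof.
move=> e0 e1; rewrite -lebesgue_qballD; [|lra..].
apply: le_measure; rewrite ?inE; [|exact: measurable_qshell|].
  by apply: measurableD; exact: measurable_qball.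
move=> x [] /=; rewrite /qball/= => h1 /negP; rewrite -ltNge => h2.
rewrite /qshell/= ler_norml lerBlDl h1 andbT.
by rewrite lerBrDl; apply: le_trans (ltW h2); lra.
Qed.

(** The removed ball has radius strictly below [1 - e], so it is disjoint from
    the closed shell and the measure of its boundary sphere does not enter. *)
Lemma lebesgue_qshell_le e r : 0 < r -> r < 1 - e -> 0 < e ->
  (leb (qshell e) <= (V * ((1 + e) ^+ d - r ^+ d))%:E)%E.
Proof.
move=> r0 re e0; rewrite -lebesgue_qballD; [|lra..].
apply: le_measure; rewrite ?inE; [exact: measurable_qshell| |].
  by apply: measurableD; exact: measurable_qball.
move=> x /=; rewrite /qball /qshell/= ler_norml lerBrDl lerBlDl => /andP[h1 h2].
move: (N x) h1 h2 => y h1 h2; split; first lra.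
by apply/negP; rewrite -ltNge; lra.
Qed.

End Ball.

Section SurfaceVolume.
Variables (d : nat) (q : R).
Hypothesis q1 : 1 < q.
Local Notation leb := (@lebesgue_tuple R d.+1).
Local Notation V := (qball_vol d.+1 q).

(** The measure of the shell is squeezed between differences of ball volumes,
    and [exprnB_ge] and [exprnB_le] turn these into multiples of the width. The
    inner radius [1 - e - e ^+ 2] widens the shell by a factor [1 + e / 2] only,
    which disappears in the limit. *)
Lemma lebesgue_qnbhd_cvg :
  ((((2 * e)^-1)%:E * leb (qnbhd q (qsphere d.+1 q) e))%E @[e --> 0^'+]) -->
  (d.+1%:R * V)%:E.
Proof.
have V0 : 0 < V by exact: qball_vol_gt0.
have cont (c k : R) : (d.+1%:R * V * (1 + c * e) ^+ d * (1 + k * e))%:E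
    @[e --> (0:R)^'+] --> (d.+1%:R * V)%:E.
  apply/cvg_EFin; first by near=> e.
  rewrite [X in _ --> X](_ : _ = d.+1%:R * V * (1 + c * 0) ^+ d * (1 + k * 0)); last first.
    by rewrite !mulr0 !addr0 expr1n !mulr1.
  apply: (@cvg_at_right_filter _ _ (fun e : R => d.+1%:R * V * (1 + c * e) ^+ d * (1 + k * e))).
  have lin (l : R) : 1 + l * e @[e --> (0 : R)] --> 1 + l * 0.
    by apply: cvgD; [exact: cvg_cst|apply: cvgM; [exact: cvg_cst|exact: cvg_id]].
  apply: cvgM; last exact: lin.
  apply: cvgM; first exact: cvg_cst.
  apply: (cvg_comp (fun e : R => 1 + c * e) (fun x => x ^+ d)); first exact: lin.
  exact: exprn_continuous.
apply: (@squeeze_cvge _ _ _ _ (fun e => (d.+1%:R * V * (1 + (-1) * e) ^+ d * (1 + 0 * e))%:E) _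
   (fun e => (d.+1%:R * V * (1 + 1 * e) ^+ d * (1 + 2^-1 * e))%:E)); [|exact: cont..].
near=> e.
  have e0 : 0 < e by near: e; exact: nbhs_right_gt.
  have e2 : e < 1 / 2 by near: e; apply: nbhs_right_lt; lra.
  have ee : e ^+ 2 <= e / 2 by rewrite expr2 ler_pM2l; lra.
  have e20 : 0 < e ^+ 2 by rewrite exprn_gt0.
have e1 : e < 1 by lra.
rewrite (@qnbhd_qsphere d.+1 q q1 _ e0 e1).
  have i0 : (0 <= (2 * e)^-1%:E)%E by rewrite lee_fin invr_ge0; lra.
  apply/andP; split.
    apply: le_trans (lee_wpmul2l i0 (@lebesgue_qshell_ge d.+1 q q1 e e0 e1)).
    rewrite -EFinM lee_fin ler_pdivlMl; last lra.
    rewrite [leLHS](_ : _ = V * (d.+1%:R * (1 - e) ^+ d * (1 + e - (1 - e)))).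
      by rewrite ler_pM2l//; apply: exprnB_ge; lra.
    by rewrite mulN1r; ring.
have r0 : 0 < 1 - e - e ^+ 2 by lra.
have re : 1 - e - e ^+ 2 < 1 - e by lra.
apply: le_trans (lee_wpmul2l i0 (@lebesgue_qshell_le d.+1 q q1 e _ r0 re e0)) _.
rewrite -EFinM lee_fin ler_pdivrMl; last lra.
rewrite [leRHS](_ : _ = V * (d.+1%:R * (1 + e) ^+ d * (1 + e - (1 - e - e ^+ 2)))).
  by rewrite ler_pM2l//; apply: exprnB_le; lra.
by rewrite mul1r; field.
Unshelve. all: by end_near. Qed.

Lemma surface_volume_qsphere : surface_volume q (qsphere d.+1 q) = d.+1%:R * V.
Proof. by rewrite /surface_volume (cvg_lim _ lebesgue_qnbhd_cvg). Qed.

End SurfaceVolume.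
End Scaling.

(** * Radial lattice sums *)

Section FsetSums.
Variables (R : realType) (T : choiceType).
Implicit Types (A B : set T) (F : T -> R).

Lemma fset_sum_sub A B F : finite_set B -> A `<=` B ->
  \sum_(x <- fset_set A) F x = \sum_(x <- fset_set B | x \in A) F x.
Proof.
move=> fB AB; have fA := sub_finite_set AB fB.
rewrite -[RHS]big_filter; apply: perm_big; apply: uniq_perm.
- exact: fset_uniq.
- exact/filter_uniq/fset_uniq.
move=> x; rewrite mem_filter !in_fset_set//.
by apply/idP/andP => [xA|[]//]; split => //; rewrite inE; apply: AB; rewrite -inE.
Qed.

Lemma le_fset_sum A B F : finite_set B -> A `<=` B -> (forall x, 0 <= F x) ->
  \sum_(x <- fset_set A) F x <= \sum_(x <- fset_set B) F x.
Proof.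
move=> fB AB F0; rewrite (fset_sum_sub F fB AB) [leRHS](bigID (fun x => x \in A))/=.
by rewrite lerDl sumr_ge0.
Qed.

End FsetSums.

Lemma ratio_near1 (R : realType) (d : nat) (a e : R) : 0 < e ->
  exists2 m, (0 < m)%N & forall k, (m <= k)%N ->
    `|(1 + a / k%:R) ^+ d - 1| <= e.
Proof.
move=> e0.
have h : (1 + a * k%:R^-1) ^+ d @[k --> \oo] --> (1 + a * 0) ^+ d.
  apply: (cvg_comp (fun k : nat => 1 + a * k%:R^-1) (fun x => x ^+ d)).
    apply: cvgD; first exact: cvg_cst.
    apply: cvgM; first exact: cvg_cst.
    by rewrite -(cvg_shiftS); exact: cvg_harmonic.
  exact: exprn_continuous.
rewrite mulr0 addr0 expr1n in h.
move/cvgrPdist_le : h => /(_ e e0)[m _ hm].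
exists m.+1 => // k mk; rewrite distrC; apply: hm => /=; exact: ltnW.
Qed.

(** Room for absorbing the second-order term of a product of two factors close
    to 1. *)
Lemma small_third (R : realType) (e : R) : 0 < e ->
  exists t, [/\ 0 < t, t < 1 & 3 * t <= e].
Proof.
move=> e0; exists (e / (3 + e)); split; first by rewrite divr_gt0//; lra.
  by rewrite ltr_pdivrMr; lra.
rewrite mulrA ler_pdivrMr; last lra.
by rewrite mulrC ler_wpM2l// ?ltW//; lra.
Qed.

Section LatticeSums.
Variables (R : realType) (d : nat) (q : R).
Hypothesis q1 : 1 < q.
Local Notation V := (@qball_vol R d.+1 q).
Local Notation nrm x := (@latnorm R d.+1 q x).
Implicit Types (x : 'rV[int]_d.+1) (F : 'rV[int]_d.+1 -> R).

(** Rounding the norm up to an integer makes radial lattice sums accessible to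
    Abel summation against the counting function [latcount]. *)
Definition level x : nat := `|Num.ceil (nrm x)|%N.

Lemma latnorm_ge0 x : 0 <= nrm x. Proof. exact: lqnorm_ge0. Qed.

Lemma levelE x : (level x)%:~R = (Num.ceil (nrm x))%:~R :> R.
Proof.
rewrite /level gez0_abs// ceil_ge0; apply: lt_le_trans (latnorm_ge0 x).
by rewrite ltrN10.
Qed.

Lemma level_le x k : (level x <= k)%N = (nrm x <= k%:R).
Proof.
rewrite -(ler_nat R) -[(level x)%:R]/((level x)%:~R) levelE.
by rewrite -[k%:R]/(k%:~R) ler_int ceil_le_int.
Qed.

Lemma latnorm_le_level x : nrm x <= (level x)%:R.
Proof. by rewrite -level_le. Qed.

Lemma level_lt x : (level x)%:R < nrm x + 1.
Proof.
rewrite -[(level x)%:R]/((level x)%:~R) levelE -ltrBlDr.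
by have := ceil_itv (nrm x); rewrite rmorphB/= => /andP[].
Qed.

Local Notation L n := (fset_set (latball q n%:R : set 'rV[int]_d.+1)).
Local Notation Ncount k := (latcount d.+1 q k%:R).

Lemma mem_levels n x : (x \in L n) = (level x <= n)%N.
Proof.
rewrite level_le in_fset_set; last exact: finite_latball.
by apply/idP/idP; rewrite inE.
Qed.

Lemma sum_levels_restrict n m F : (m <= n)%N ->
  \sum_(x <- L n | (level x <= m)%N) F x = \sum_(x <- L m) F x.
Proof.
move=> mn; rewrite -big_filter; apply: perm_big; apply: uniq_perm.
- exact/filter_uniq/fset_uniq.
- exact: fset_uniq.
move=> x; rewrite mem_filter !mem_levels.
by case: leqP => //= /leq_trans; apply.
Qed.

Lemma sum_levels_low n m F : (forall x, 0 <= F x) ->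
  \sum_(x <- L n | (level x <= m)%N) F x <= \sum_(x <- L m) F x.
Proof.
move=> F0; have [mn|nm] := leqP m n; first by rewrite sum_levels_restrict.
apply: le_trans (_ : \sum_(x <- L n) F x <= _).
  by rewrite big_mkcond/=; apply: ler_sum => x _; case: ifP.
apply: le_fset_sum => //; first exact: finite_latball.
by move=> x /= /le_trans; apply; rewrite ler_nat ltnW.
Qed.

(** Abel summation reduces a radial sum to the counting function, the quantity
    that the comparison with volumes controls. *)
Lemma level_sum (w : nat -> R) n :
  \sum_(x <- L n) w (level x) =
  (Ncount n)%:R * w n + \sum_(0 <= k < n) (Ncount k)%:R * (w k - w k.+1).
Proof.
have cnt k : (k <= n)%N -> (Ncount k)%:R = \sum_(x <- L n | (level x <= k)%N) (1 : R).
  move=> kn; rewrite sum_levels_restrict// big_const_seq count_predT iter_addr addr0.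
  by [].
transitivity (\sum_(x <- L n) (w n + \sum_(0 <= k < n) if (level x <= k)%N then w k - w k.+1
  else 0)).
  rewrite big_seq [RHS]big_seq; apply: eq_bigr => x; rewrite mem_levels => xn.
  rewrite (big_cat_nat (n := level x))//= [X in _ + (X + _)]big_nat_cond big1 ?add0r;
    last first.
    by move=> k /andP[/andP[_ kx] _]; rewrite leqNgt kx.
  rewrite (eq_big_nat _ _ (F2 := fun k => - (w k.+1 - w k))); last first.
    by move=> k /andP[-> _]; rewrite opprB.
  by rewrite sumrN telescope_sumr// opprB subrKC.
rewrite big_split/= cnt// mulr_suml; congr (_ + _).
  rewrite big_seq [RHS]big_seq_cond; apply: eq_big => x; last by rewrite mul1r.
  by rewrite mem_levels andbb.
rewrite exchange_big/= big_nat [RHS]big_nat; apply: eq_bigr => k /andP[_ kn].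
by rewrite cnt ?(ltnW kn)// mulr_suml [RHS]big_mkcond; apply: eq_bigr => x _; rewrite mul1r.
Qed.

(** The radial weight |x|^-(d+1), with the value 1 at the origin. *)
Definition lev_weight (k : nat) : R := (maxn k 1)%:R ^- d.+1.

Lemma lev_weight_ge0 k : 0 <= lev_weight k.
Proof. by rewrite /lev_weight invr_ge0 exprn_ge0. Qed.

Lemma latcount_le_pow : exists2 C : R, 0 <= C & forall k, (0 < k)%N ->
  (Ncount k)%:R <= C * k%:R ^+ d.+1.
Proof.
exists (V * (1 + d.+1%:R) ^+ d.+1).
  by rewrite mulr_ge0 ?exprn_ge0 ?ltW ?qball_vol_gt0// ltW// addr_gt0.
move=> k k0; apply: le_trans (latcount_leV q1 _ _) _ => //.
rewrite -mulrA ler_pM2l ?qball_vol_gt0// -exprMn lerXn2r ?nnegrE ?addr_ge0 ?mulr_ge0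
  ?addr_ge0//.
by rewrite mulrDl mul1r lerD2l ler_peMr// ler1n.
Qed.

Lemma latcount_near (e : R) : 0 < e -> exists2 m, (0 < m)%N & forall k, (m <= k)%N ->
  (1 - e) * V * k%:R ^+ d.+1 <= (Ncount k)%:R <= (1 + e) * V * k%:R ^+ d.+1.
Proof.
move=> e0; have V0 := qball_vol_gt0 q1 (ltn0Sn d).
have [m1 m10 h1] := ratio_near1 d.+1 d.+1%:R e0.
have [m2 m20 h2] := ratio_near1 d.+1 (- d.+1%:R) e0.
exists (m1 + m2 + d.+1).+1 => // k km.
have k0 : 0 < k%:R :> R by rewrite ltr0n; lia.
apply/andP; split.
  have := @latcount_geV R d.+1 q q1 (k%:R - d.+1%:R); rewrite subrK => h.
  apply: le_trans (h _); last by rewrite subr_gt0 ltr_nat; lia.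
  rewrite (_ : k%:R - d.+1%:R = (1 + - d.+1%:R / k%:R) * k%:R); last by field; exact: lt0r_neq0.
  rewrite exprMn mulrA [_ * V]mulrC ler_wpM2r ?exprn_ge0 ?(ltW k0)// ler_pM2l//.
  have := h2 k; rewrite ler_norml => /(_ _)/andP[|]; [lia|lra].
apply: le_trans (latcount_leV q1 _ _) _; rewrite ?(ltW k0)//.
rewrite (_ : k%:R + d.+1%:R = (1 + d.+1%:R / k%:R) * k%:R); last by field; exact: lt0r_neq0.
rewrite exprMn mulrA [_ * V]mulrC ler_wpM2r ?exprn_ge0 ?(ltW k0)// ler_pM2l//.
have := h1 k; rewrite ler_norml => /(_ _)/andP[|]; [lia|lra].
Qed.

Lemma lev_weightB k : (0 < k)%N ->
  lev_weight k - lev_weight k.+1 = (1 - (k%:R / k.+1%:R) ^+ d.+1) * k%:R ^- d.+1.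
Proof.
move=> k0; rewrite /lev_weight (maxn_idPl k0) (maxn_idPl (ltn0Sn k)).
rewrite mulrBl mul1r expr_div_n; congr (_ - _).
by rewrite mulrAC divff ?mul1r// expf_neq0// pnatr_eq0 -lt0n.
Qed.

Lemma lev_weightB_ge0 k : 0 <= lev_weight k - lev_weight k.+1.
Proof.
rewrite subr_ge0 /lev_weight lef_pV2 ?posrE ?exprn_gt0 ?ltr0n ?leq_max ?orbT//.
rewrite lerXn2r ?nnegrE// ler_nat; lia.
Qed.

(** Abel summation produces the differences of the weight. They are compared
    with increments of the logarithm, which telescope to [ln n]. *)
Lemma lev_weightB_le k : (0 < k)%N ->
  (lev_weight k - lev_weight k.+1) * k%:R ^+ d.+1 <= d.+1%:R * (ln k.+1%:R - ln k%:R).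
Proof.
move=> k0; have k0' : 0 < k%:R :> R by rewrite ltr0n.
rewrite lev_weightB// -mulrA mulVf ?mulr1; last by rewrite expf_neq0// lt0r_neq0.
have r1 : k%:R / k.+1%:R <= 1 :> R by rewrite ler_pdivrMr ?mul1r ?ler_nat.
have := exprnB_le d (divr_ge0 (ltW k0') (ler0n R k.+1)) r1.
rewrite !expr1n mulr1 => /le_trans; apply; rewrite ler_pM2l//.
apply: le_trans (ln_subr_ge _ _) => //.
rewrite le_eqVlt; apply/orP; left; apply/eqP.
by rewrite -natr1; field; rewrite natr1 pnatr_eq0.
Qed.

Lemma lev_weightB_ge k : (0 < k)%N ->
  d.+1%:R * (k%:R / k.+1%:R) ^+ d.+1 * (ln k.+1%:R - ln k%:R) <=
  (lev_weight k - lev_weight k.+1) * k%:R ^+ d.+1.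
Proof.
move=> k0; have k0' : 0 < k%:R :> R by rewrite ltr0n.
rewrite lev_weightB// -[leRHS]mulrA mulVf ?mulr1; last by rewrite expf_neq0// lt0r_neq0.
have r1 : k%:R / k.+1%:R <= 1 :> R by rewrite ler_pdivrMr ?mul1r ?ler_nat.
have r0 := divr_ge0 (ltW k0') (ler0n R k.+1).
have := exprnB_ge d r0 r1.
rewrite expr1n; apply: le_trans.
set rho := k%:R / k.+1%:R in r0 r1 *.
rewrite [leLHS](_ : _ = d.+1%:R * rho ^+ d * (rho * (ln k.+1%:R - ln k%:R)));
  last by rewrite exprSr; ring.
rewrite ler_wpM2l ?mulr_ge0 ?exprn_ge0// /rho.
apply: le_trans (_ : k%:R / k.+1%:R * ((k.+1%:R - k%:R) / k%:R) <= _).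
  by rewrite ler_wpM2l// ln_subr_le.
rewrite le_eqVlt; apply/orP; left; apply/eqP.
by rewrite -natr1; field; rewrite natr1 !pnatr_eq0 -!lt0n.
Qed.

Local Notation t k := ((Ncount k)%:R * (lev_weight k - lev_weight k.+1)).

Lemma level_term_ge0 k : 0 <= t k.
Proof. by rewrite mulr_ge0// lev_weightB_ge0. Qed.

Lemma ln_natB_ge0 k : 0 <= ln k.+1%:R - ln k%:R :> R.
Proof.
case: k => [|k]; first by rewrite ln1 ln0// subr0.
by rewrite subr_ge0 ler_ln ?posrE ?ltr0n// ler_nat.
Qed.

(** By polar coordinates the sum of |x|^-D over the ball of radius n in
    dimension D is asymptotic to D V ln n. The estimate [latcount_near] of the
    counting function holds from some rank on; the finitely many remaining
    levels are collected in M. *)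
Lemma log_sum_le (e : R) : 0 < e -> exists M, forall n, (0 < n)%N ->
  \sum_(x <- L n) lev_weight (level x) <= (1 + e) * (d.+1%:R * V) * ln n%:R + M.
Proof.
move=> e0; have V0 := qball_vol_gt0 q1 (ltn0Sn d).
have [C C0 hC] := latcount_le_pow.
have [m m0 hm] := latcount_near e0.
exists (C + \sum_(0 <= k < m) t k) => n n0.
rewrite level_sum addrC [leRHS]addrCA [leRHS]addrC; apply: lerD; last first.
  rewrite /lev_weight (maxn_idPl n0) ler_pdivrMr ?hC//.
  by rewrite exprn_gt0// ltr0n.
set c := (1 + e) * _.
have c0 : 0 <= c by rewrite /c !mulr_ge0 ?(ltW V0)//; lra.
apply: le_trans (_ : \sum_(0 <= k < n) (c * (ln k.+1%:R - ln k%:R) +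
    (if (k < m)%N then t k else 0)) <= _).
  apply: ler_sum => k _; case: ltnP => [km|km].
    by rewrite lerDr mulr_ge0// ln_natB_ge0.
  rewrite addr0; have k0 : (0 < k)%N by exact: leq_trans m0 km.
  have /andP[_ h] := hm k km.
  apply: le_trans (ler_wpM2r (lev_weightB_ge0 k) h) _.
  have cV : 0 <= (1 + e) * V by rewrite mulr_ge0 ?(ltW V0)//; lra.
  rewrite [leRHS](_ : _ = (1 + e) * V * (d.+1%:R * (ln k.+1%:R - ln k%:R))).
    rewrite [leLHS](_ : _ = (1 + e) * V * ((lev_weight k - lev_weight k.+1) * k%:R ^+ d.+1)).
      by rewrite ler_wpM2l// lev_weightB_le.
    by ring.
  by rewrite /c; ring.
rewrite big_split/= -mulr_sumr telescope_sumr// [ln 0%:R]ln0// subr0 lerD2l.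
rewrite -big_mkcond/= big_nat_cond.
have [nm|mn] := leqP n m.
  rewrite [leRHS](big_cat_nat (n := n))//= ler_wpDr ?sumr_ge0//.
    by move=> k _; exact: level_term_ge0.
  rewrite [leRHS]big_nat le_eqVlt; apply/orP; left; apply/eqP; apply: eq_bigl => k.
  by rewrite /=; lia.
rewrite -big_nat_cond (big_cat_nat (n := m)) ?(ltnW mn)//=.
rewrite [X in _ + X]big_nat_cond [X in _ + X]big1 ?addr0; last by move=> k; lia.
by rewrite [leLHS]big_nat_cond [leRHS]big_nat le_eqVlt; apply/orP; left; apply/eqP;
  apply: eq_bigl => k; lia.
Qed.

Lemma log_sum_ge (e : R) : 0 < e -> e < 1 -> exists M, forall n, (0 < n)%N ->
  (1 - e) * (d.+1%:R * V) * ln n%:R - M <= \sum_(x <- L n) lev_weight (level x).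
Proof.
move=> e0 e1; have V0 := qball_vol_gt0 q1 (ltn0Sn d).
have e20 : 0 < e / 2 by lra.
have [m m0 hm] := latcount_near e20.
have [m' m'0 hm'] := ratio_near1 d.+1 (-1) e20.
set c := (1 - e) * _.
have c0 : 0 <= c by rewrite /c !mulr_ge0 ?(ltW V0)//; lra.
exists (c * ln (m + m')%:R) => n n0.
rewrite level_sum ler_wpDl//.
  by rewrite mulr_ge0// lev_weight_ge0.
have [nm|mn] := leqP n (m + m').
  apply: le_trans (sumr_ge0 _ (fun k _ => level_term_ge0 k)).
  by rewrite subr_le0 ler_wpM2l// ler_ln ?posrE ?ltr0n ?ler_nat// addn_gt0 m0.
rewrite (big_cat_nat (n := (m + m')%N))//=; last exact: ltnW.
rewrite ler_wpDl ?sumr_ge0//; first by move=> k _; exact: level_term_ge0.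
rewrite -mulrBr -(telescope_sumr (fun k => ln k%:R)) ?(ltnW mn)// mulr_sumr.
apply: ler_sum_nat => k /andP[mk kn].
have k0 : (0 < k)%N by lia.
have k0' : 0 < k%:R :> R by rewrite ltr0n.
have /andP[h _] := hm k (leq_trans (leq_addr _ _) mk).
apply: le_trans (ler_wpM2r (lev_weightB_ge0 k) h).
rewrite -[leRHS]mulrA [_ ^+ _ * _]mulrC.
have v0 : 0 <= (1 - e / 2) * V by rewrite mulr_ge0 ?(ltW V0)//; lra.
apply: le_trans (ler_wpM2l v0 (lev_weightB_ge k0)).
rewrite !mulrA ler_wpM2r ?ln_natB_ge0//.
have := hm' k.+1; rewrite (_ : 1 + -1 / k.+1%:R = k%:R / k.+1%:R); last first.
  by rewrite -natr1; field; rewrite natr1 pnatr_eq0.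
rewrite ler_norml => /(_ _)/andP[|h1 h2]; first lia.
move: h1; move: ((k%:R / k.+1%:R) ^+ d.+1) => y h1.
rewrite /c -!mulrA [V * _]mulrCA [X in _ <= (_ * (_ * X))]mulrC.
rewrite [leRHS](_ : _ = ((1 - e / 2) * y) * (d.+1%:R * V)); last by ring.
rewrite ler_wpM2r ?mulr_ge0 ?(ltW V0)//; nra.
Qed.

(** Every edge quantity below is asymptotic to the radial weight, and only that
    leading behaviour influences the coefficient of [ln n]. *)
Lemma sum_latball_log_le F :
  (forall e, 0 < e -> exists m, forall x, (m <= level x)%N ->
    F x <= (1 + e) * (level x)%:R ^- d.+1) ->
  forall e, 0 < e -> exists M, forall n, (0 < n)%N ->
    \sum_(x <- L n) F x <= (1 + e) * (d.+1%:R * V) * ln n%:R + M.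
Proof.
move=> hF e e0; have V0 := qball_vol_gt0 q1 (ltn0Sn d).
have [e' [e'0 ee']] : exists e', 0 < e' /\ (1 + e') * (1 + e') <= 1 + e.
  by have [s [s0 s1 s3]] := small_third e0; exists s; split=> //; nra.
have [m hm] := hF e' e'0.
have [M hM] := log_sum_le e'0.
exists ((1 + e') * M + \sum_(x <- L m.+1) `|F x|) => n n0.
apply: le_trans (_ : \sum_(x <- L n) ((1 + e') * lev_weight (level x) +
   if (level x <= m.+1)%N then `|F x| else 0) <= _).
  apply: ler_sum => x _; case: leqP => xm.
    apply: le_trans (ler_norm _) _; rewrite lerDr mulr_ge0 ?lev_weight_ge0//; lra.
  rewrite addr0; have := hm x; rewrite /lev_weight (maxn_idPl _); last lia.
  by apply; lia.
rewrite big_split/= addrA; apply: lerD.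
  rewrite -mulr_sumr; apply: le_trans (ler_wpM2l _ (hM n n0)) _; first lra.
  rewrite mulrDr lerD2r !mulrA !ler_wpM2r ?ln_ge0 ?ler1n ?(ltW V0)//.
rewrite -big_mkcond/=.
by apply: sum_levels_low => x.
Qed.

Lemma sum_latball_log_ge F :
  (forall e, 0 < e -> exists m, forall x, (m <= level x)%N ->
    (1 - e) * (level x)%:R ^- d.+1 <= F x) ->
  forall e, 0 < e -> exists M, forall n, (0 < n)%N ->
    (1 - e) * (d.+1%:R * V) * ln n%:R - M <= \sum_(x <- L n) F x.
Proof.
move=> hF e e0; have V0 := qball_vol_gt0 q1 (ltn0Sn d).
have [e' [e'0 e'1 ee']] : exists e', [/\ 0 < e', e' < 1 & 1 - e <= (1 - e') * (1 - e')].
  by have [s [s0 s1 s3]] := small_third e0; exists s; split=> //; nra.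
have [m hm] := hF e' e'0.
have [M hM] := log_sum_ge e'0 e'1.
exists ((1 - e') * M + \sum_(x <- L m.+1) (lev_weight (level x) + `|F x|)) => n n0.
apply: le_trans (_ : _ <= \sum_(x <- L n) ((1 - e') * lev_weight (level x) -
   if (level x <= m.+1)%N then lev_weight (level x) + `|F x| else 0)) _; last first.
  apply: ler_sum => x _; case: leqP => xm.
    have := ler_norm (- F x); rewrite normrN; have := lev_weight_ge0 (level x); nra.
  rewrite subr0; have := hm x; rewrite /lev_weight (maxn_idPl _); last lia.
  by apply; lia.
rewrite sumrB opprD addrA; apply: lerB.
  rewrite -mulr_sumr; apply: le_trans (ler_wpM2l _ (hM n n0)); last lra.
  rewrite mulrBr lerD2r !mulrA !ler_wpM2r ?ln_ge0 ?ler1n ?(ltW V0)//.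
have g0 x : 0 <= lev_weight (level x) + `|F x| by rewrite addr_ge0 ?lev_weight_ge0.
rewrite -big_mkcond/=.
by apply: sum_levels_low => x.
Qed.

(** In dimension D the sum of |x|^-(D+1) converges, with a tail of order 1 / m.
    Freezing the weight below level [m + 1] makes the lower levels drop out of
    the Abel sum. *)
Lemma level_tail_sum : exists2 C : R, 0 <= C & forall m n, (0 < m)%N ->
  \sum_(x <- L n | (m < level x)%N) (level x)%:R ^- d.+2 <= C / m%:R.
Proof.
have [C C0 hC] := latcount_le_pow.
exists (C * (1 + d.+2%:R)); first by rewrite mulr_ge0// addr_ge0.
move=> m n m0; have m0' : 0 < m%:R :> R by rewrite ltr0n.
have [nm|mn] := leqP n m.
  rewrite big_seq_cond big1; last by move=> x /andP[]; rewrite mem_levels; lia.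
  by rewrite divr_ge0// mulr_ge0// addr_ge0.
(* Constant up to level m + 1, so its differences vanish there. *)
pose w k : R := (maxn k m.+1)%:R ^- d.+2.
apply: le_trans (_ : \sum_(x <- L n) w (level x) <= _).
  rewrite big_mkcond/=; apply: ler_sum => x _; case: ifP => xm.
    by rewrite /w (maxn_idPl _)//.
  by rewrite /w invr_ge0 exprn_ge0.
rewrite level_sum mulrDr mulr1 mulrDl; apply: lerD.
  rewrite /w (maxn_idPl mn); have n0 : (0 < n)%N by lia.
  have n0' : 0 < n%:R :> R by rewrite ltr0n.
  apply: le_trans (ler_wpM2r _ (hC n n0)) _; first by rewrite invr_ge0 exprn_ge0.
  rewrite -mulrA ler_wpM2l// [n%:R ^+ d.+2]exprSr invfM mulrA mulfV;
    last by rewrite expf_neq0// lt0r_neq0.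
  by rewrite mul1r lef_pV2 ?posrE// ler_nat ltnW.
rewrite (big_cat_nat (n := m.+1))//= [X in X + _]big_nat_cond [X in X + _]big1 ?add0r;
  last first.
  by move=> k km; rewrite /w !(maxn_idPr _) ?subrr ?mulr0//; lia.
apply: le_trans (_ : \sum_(m.+1 <= k < n) (C * d.+2%:R * (k.-1%:R^-1 - k%:R^-1)) <= _).
  apply: ler_sum_nat => k /andP[mk kn].
  have k0 : (0 < k)%N by lia.
  have k0' : 0 < k%:R :> R by rewrite ltr0n.
  have k1 : 0 < k.-1%:R :> R by rewrite ltr0n; lia.
  rewrite /w !(maxn_idPl _); [|lia..].
  have h : k%:R ^- d.+2 - k.+1%:R ^- d.+2 <= d.+2%:R * (k.+1%:R - k%:R) * k%:R ^- d.+3 :> R.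
    by apply: invXnB_le => //; rewrite ler_nat.
  have w0 : 0 <= k%:R ^- d.+2 - k.+1%:R ^- d.+2 :> R.
    by rewrite subr_ge0 lef_pV2 ?posrE ?exprn_gt0 ?ltr0n// lerXn2r ?nnegrE// ler_nat.
  apply: le_trans (ler_wpM2r w0 (hC k k0)) _.
  have ck : 0 <= C * k%:R ^+ d.+1 by rewrite mulr_ge0// exprn_ge0.
  apply: le_trans (ler_wpM2l ck h) _.
  rewrite [leLHS](_ : _ = C * d.+2%:R * (k%:R ^- 2)); last first.
    rewrite [k%:R ^+ d.+3]exprS [k%:R ^+ d.+2]exprS -natr1; field.
    by rewrite expf_neq0 lt0r_neq0.
  rewrite ler_wpM2l ?mulr_ge0//.
  rewrite (_ : k%:R = k.-1%:R + 1); last by rewrite natr1 prednK.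
  rewrite (_ : _ - _ = (k.-1%:R * (k.-1%:R + 1))^-1); last by field;
    rewrite !lt0r_neq0// ltr_wpDl.
  by rewrite lef_pV2 ?posrE ?exprn_gt0 ?mulr_gt0 ?ltr_wpDl ?(ltW k1)// expr2 ler_wpM2r
    ?addr_ge0// lerDl.
rewrite -mulr_sumr ler_wpM2l ?mulr_ge0//.
rewrite (eq_big_nat _ _ (F2 := fun k => - (k.+1.-1%:R^-1 - k.-1%:R^-1))); last first.
  by move=> k _; rewrite opprB.
rewrite sumrN telescope_sumr// opprB/= lerBlDr lerDl invr_ge0.
exact: ler0n.
Qed.

End LatticeSums.

(** * The logarithmic potential along an edge *)

Section RealAux.
Variable R : realType.
Implicit Types a b q t : R.

Lemma normr_lnB_le a b c : 0 < c -> c <= a -> c <= b ->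
  `|ln b - ln a| <= `|b - a| / c.
Proof.
move=> c0 ca cb; have a0 := lt_le_trans c0 ca; have b0 := lt_le_trans c0 cb.
have h (x y : R) : 0 < x -> 0 < y -> c <= x -> ln y - ln x <= `|y - x| / c.
  move=> x0 y0 cx; apply: le_trans (ln_subr_le x0 y0) _.
  apply: le_trans (_ : `|y - x| / x <= _).
    by rewrite ler_wpM2r ?invr_ge0 ?(ltW x0)// ler_norm.
  by rewrite ler_wpM2l// lef_pV2.
rewrite ler_norml h// andbT lerNl opprB distrC; exact: h.
Qed.

Lemma normr_powRB_le q a b M : 1 < q -> 0 <= a -> 0 <= b -> a <= M -> b <= M ->
  `|b - a| <= 1 -> `|b `^ q - a `^ q| <= q * M `^ (q - 1).
Proof.
move=> q1 a0 b0 aM bM ab1.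
have h (x y : R) : 0 <= x -> 0 <= y -> y <= M -> `|y - x| <= 1 ->
  y `^ q - x `^ q <= q * M `^ (q - 1).
  move=> x0 y0 yM xy; apply: le_trans (powRB_le q1 x0 y0) _.
  apply: le_trans (_ : q * y `^ (q - 1) * 1 <= _).
    rewrite ler_wpM2l ?mulr_ge0 ?powR_ge0//; first lra.
    by apply: le_trans (ler_norm _) xy.
  by rewrite mulr1 ler_wpM2l ?ler_powR_base//; lra.
by rewrite ler_norml h// andbT lerNl opprB h// distrC.
Qed.

(** Real exponents up to n are handled through the integer exponent n. *)
Lemma small_ratio (n : nat) (e : R) : 0 < e ->
  exists eta, [/\ 0 < eta, eta <= 1 & (1 + eta) ^+ n <= 1 + e].
Proof.
move=> e0; have [m m0 /(_ m (leqnn m))] := ratio_near1 n 1 e0.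
rewrite ler_norml div1r => /andP[_ h]; exists m%:R^-1; split.
- by rewrite invr_gt0 ltr0n.
- by rewrite invf_le1 ?ler1n// ltr0n.
- lra.
Qed.

Lemma level_scale (a eta : R) : 0 < eta -> exists m, forall k, (m <= k)%N ->
  k%:R + a <= (1 + eta) * k%:R /\ k%:R <= (1 + eta) * (k%:R - a) :> R.
Proof.
move=> eta0; have p : 0 <= (1 + eta) * `|a| / eta.
  by rewrite !mulr_ge0// ?invr_ge0; lra.
exists (Num.bound ((1 + eta) * `|a| / eta)) => k mk.
have := archi_boundP p; rewrite -(ler_nat R) in mk => h.
have {}h := lt_le_trans h mk.
rewrite ltr_pdivrMr// in h.
have := ler_norm a; have : 0 <= eta * `|a| by rewrite mulr_ge0// ltW.
by split; nra.
Qed.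

End RealAux.

Section Edges.
Variables (R : realType) (d : nat).
Hypothesis d0 : (0 < d)%N.
Local Notation q := (conj_exp R d.+1).
Local Notation pt := 'rV[int]_d.+1.
Local Notation nrm x := (@latnorm R d.+1 q x).
Local Notation e_ i := (delta_mx ord0 i : pt).
Implicit Types (x y : pt) (i j : 'I_d.+1).

Lemma q_gt1 : 1 < q. Proof. exact: conj_exp_gt1. Qed.
Hint Resolve q_gt1 : core.
Lemma q_gt0 : 0 < q. Proof. by have := q_gt1; lra. Qed.
Lemma conj_exp_pred : q * d%:R = d.+1%:R.
Proof. by rewrite -(@conj_expM R d.+1)// -natr1 addrK. Qed.
Lemma q_le2 : q <= 2. Proof. exact: conj_exp_le2. Qed.

(** The q-th power of the norm separates the coordinates: moving along an edge
    changes a single term. *)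
Definition qpow x : R := \sum_i `|(x ord0 i)%:~R| `^ q.

Lemma latnorm_powR x : nrm x `^ q = qpow x.
Proof. by rewrite lqnorm_powR. Qed.

Lemma qpow_ge0 x : 0 <= qpow x. Proof. by rewrite -latnorm_powR powR_ge0. Qed.

Lemma latnorm_exprD x : nrm x ^+ d.+1 = qpow x ^+ d.
Proof.
have := latnorm_ge0 q x => n0.
by rewrite -powR_mulrn// -conj_exp_pred powRrM latnorm_powR powR_mulrn// qpow_ge0.
Qed.

Lemma latnorm_eq0 x : (nrm x == 0) = (x == 0).
Proof.
apply/eqP/eqP => [x0|->].
  apply/rowP => i; have := coord_le_latnorm q_gt1 x i.
  by rewrite x0 mxE -[0]/(0%:~R : R) ler_int normr_le0 => /eqP.
apply/eqP; rewrite eq_le latnorm_ge0 andbT; apply: lqnorm_le => //.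
by rewrite big1 ?powR_ge0// => i _; rewrite mxE normr0 powR0// gt1_neq0.
Qed.

Lemma latnorm_ge1 x : x != 0 -> 1 <= nrm x.
Proof.
move=> x0; have [i xi] : exists i, x ord0 i != 0.
  apply/existsP; apply: contraR x0; rewrite negb_exists => /forallP h.
  by apply/eqP/rowP => i; rewrite mxE; have := h i; rewrite negbK => /eqP.
apply: le_trans (coord_le_latnorm q_gt1 x i); rewrite -[1]/(1%:~R) ler_int; lia.
Qed.

Lemma addeE x i j : (x + e_ i) ord0 j = x ord0 j + (j == i)%:R.
Proof. by rewrite !mxE eqxx. Qed.

Lemma qpow_adde x i :
  qpow (x + e_ i) - qpow x = `|(x ord0 i + 1)%:~R| `^ q - `|(x ord0 i)%:~R| `^ q.
Proof.
rewrite /qpow (bigD1 i)//= [X in _ - X](bigD1 i)//= addeE eqxx.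
rewrite (eq_bigr (fun j => `|(x ord0 j)%:~R| `^ q)); last first.
  by move=> j ji; rewrite addeE (negbTE ji) addr0.
by rewrite opprD addrACA subrr addr0.
Qed.

Lemma latnorm_delta i : nrm (e_ i) = 1.
Proof.
rewrite /latnorm lqnormE (bigD1 i)//= big1 => [|j ji].
  by rewrite mxE !eqxx addr0 normr1 !powR1.
by rewrite mxE (negbTE ji) andbF normr0 powR0// gt1_neq0.
Qed.

Lemma latnormD x y : nrm (x + y) <= nrm x + nrm y.
Proof.
apply: le_trans (lqnormD q_gt1 _ _).
by apply: le_lqnorm => // i; rewrite mxE rmorphD.
Qed.

Lemma latnormN x : nrm (- x) = nrm x.
Proof. by apply: eq_lqnorm => i; rewrite mxE rmorphN normrN. Qed.

Lemma latnorm_adde_le x i : nrm (x + e_ i) <= nrm x + 1.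
Proof. by rewrite -(latnorm_delta i) latnormD. Qed.

Lemma latnorm_adde_ge x i : nrm x - 1 <= nrm (x + e_ i).
Proof.
by rewrite lerBlDr -(latnorm_delta i) -(latnormN (e_ i)); apply: le_trans (latnormD _ _);
  rewrite addrK.
Qed.

Lemma latnorm_sube_ge x i : nrm x - 1 <= nrm (x - e_ i).
Proof. by have := latnorm_adde_le (x - e_ i) i; rewrite subrK lerBlDr. Qed.

Lemma latnorm_adde_mono x i : (0 <= x ord0 i -> nrm x <= nrm (x + e_ i)) /\
  (x ord0 i < 0 -> nrm (x + e_ i) <= nrm x).
Proof.
split => xi; apply: le_lqnorm => // j; rewrite addeE -!intr_norm ler_int;
  case: eqVneq => [->|_]; lia.
Qed.

Lemma latnormE x : nrm x = lqnorm q (fun i => (x ord0 i)%:~R).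
Proof. by []. Qed.

(** The continuum minimiser up to normalisation: the gradient of |x|_q has unit
    norm for the conjugate exponent, so that of log |x|_q has norm 1 / |x|_q. At
    the origin the convention ln 0 = 0 is the boundary condition. *)
Definition logpot x : R := ln (nrm x).

Lemma logpot0 : logpot 0 = 0.
Proof. by rewrite /logpot (eqP (_ : nrm 0 == 0)) ?latnorm_eq0// ln0. Qed.

Lemma logpot_ge0 x : 0 <= logpot x.
Proof.
have [->|x0] := eqVneq x 0; first by rewrite logpot0.
by rewrite ln_ge0// latnorm_ge1.
Qed.

Lemma logpot_mono x y : nrm x <= nrm y -> logpot x <= logpot y.
Proof.
have [->|x0] := eqVneq x 0; first by rewrite logpot0 logpot_ge0.
have := latnorm_ge1 x0 => h1 h2.
by rewrite ler_ln ?posrE//; lra.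
Qed.

Lemma logpotE x : logpot x = q^-1 * ln (qpow x).
Proof. by rewrite -latnorm_powR ln_powR mulKf// gt1_neq0. Qed.

Lemma logpot_edge_le x i : 1 < nrm x ->
  `|logpot x - logpot (x + e_ i)| <=
     (`|(x ord0 i)%:~R| + 1) `^ (q - 1) / (nrm x - 1) `^ q.
Proof.
move=> x1; rewrite !logpotE -mulrBr normrM gtr0_norm ?invr_gt0 ?q_gt0//.
have n1 : 0 < nrm x - 1 by lra.
have c0 : 0 < (nrm x - 1) `^ q by rewrite powR_gt0.
have q0 := ltW q_gt0.
rewrite distrC ler_pdivrMl ?q_gt0//;
  apply: le_trans (@normr_lnB_le _ _ _ ((nrm x - 1) `^ q) c0 _ _) _.
- by rewrite -latnorm_powR ler_powR_base ?(ltW n1)//; lra.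
- by rewrite -latnorm_powR ler_powR_base ?(ltW n1)// latnorm_adde_ge.
rewrite mulrA ler_wpM2r ?invr_ge0 ?powR_ge0// qpow_adde.
apply: normr_powRB_le => //; rewrite ?lerDl// rmorphD/=.
  by apply: le_trans (ler_normD _ _) _; rewrite normr1.
apply: le_trans (ler_dist_dist _ _) _.
by rewrite addrAC subrr add0r normr1.
Qed.

(** Each term is a q-th power since (q - 1) (d + 1) = q, so the sum over the
    directions reassembles a q-norm, and Minkowski's inequality absorbs the
    shifts by 1. *)
Lemma sum_logpot_edge_le x : 1 < nrm x ->
  \sum_i `|logpot x - logpot (x + e_ i)| `^ d.+1%:R <=
  (nrm x + d.+1%:R) `^ q / (nrm x - 1) `^ (q * d.+1%:R).
Proof.
move=> x1; have n1 : 0 < nrm x - 1 by lra.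
have q0 := ltW q_gt0.
apply: le_trans (_ : \sum_i (`|(x ord0 i)%:~R| + 1) `^ q / (nrm x - 1) `^ (q * d.+1%:R) <= _).
  apply: ler_sum => i _.
  apply: le_trans (ler_powR_base _ _ (logpot_edge_le i x1)) _ => //.
  rewrite powRM ?powR_ge0 ?invr_ge0 ?powR_ge0// -powR_inv1 ?powR_ge0// -!powRrM.
  rewrite (_ : (q - 1) * d.+1%:R = q); last first.
    by rewrite mulrBl mul1r -{2}conj_exp_pred -mulrBr -natr1 addrAC subrr add0r mulr1.
  by rewrite mulN1r mulrN powRN.
rewrite -mulr_suml ler_wpM2r ?invr_ge0 ?powR_ge0//.
have -> : \sum_i (`|(x ord0 i)%:~R| + 1) `^ q = lqnorm q (fun i => `|(x ord0 i)%:~R| + 1 : R)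
  `^ q.
  by rewrite lqnorm_powR//; apply: eq_bigr => i _;
    rewrite (ger0_norm (addr_ge0 (normr_ge0 _) ler01)).
rewrite ler_powR_base ?lqnorm_ge0//; apply: le_trans (lqnormD q_gt1 _ _) _.
rewrite latnormE lerD//; first by apply: le_lqnorm => // i; rewrite normr_id.
by rewrite -[leRHS]mulr1; apply: lqnorm_le_card => // i; rewrite normr1.
Qed.

Local Notation lev x := (@level R d q x).

Lemma level_near (eta : R) : 0 < eta -> exists m, forall x, (m <= lev x)%N ->
  [/\ 1 < nrm x, (lev x)%:R / (1 + eta) <= nrm x - d.+1%:R,
      (lev x)%:R / (1 + eta) <= nrm x - 1 & nrm x + d.+1%:R <= (1 + eta) * (lev x)%:R].
Proof.
move=> eta0; have [m hm] := @level_scale R d.+2%:R _ eta0.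
exists (maxn m d.+4) => x; rewrite geq_max => /andP[/hm[h1 h2] h3].
have e1 : 0 < 1 + eta by lra.
have := latnorm_le_level q x; have := level_lt q x.
have : (4 <= (lev x)%:R :> R) by rewrite (ler_nat R 4); lia.
have : (1 <= d.+1%:R :> R) by rewrite (ler_nat R 1).
rewrite -[d.+2%:R]natr1 in h1 h2.
have h4 : (lev x)%:R / (1 + eta) <= (lev x)%:R - (d.+1%:R + 1) by rewrite ler_pdivrMr// mulrC.
by split; lra.
Qed.

Lemma sum_logpot_edge_near (e : R) : 0 < e -> exists m, forall x, (m <= lev x)%N ->
  \sum_i `|logpot x - logpot (x + e_ i)| `^ d.+1%:R <= (1 + e) * (lev x)%:R ^- d.+1.
Proof.
move=> e0; have [eta [eta0 eta1 etae]] := small_ratio (2 + 2 * d.+1) e0.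
have [m hm] := level_near eta0; exists m.+1 => x xm.
have [x1 _ h1 h2] := hm x (ltnW xm).
have k0 : 0 < (lev x)%:R :> R by rewrite ltr0n; lia.
have e1 : 0 < 1 + eta by lra.
have q0 := ltW q_gt0.
apply: le_trans (sum_logpot_edge_le x1) _.
set k := (lev x)%:R in k0 h1 h2 *.
have ke0 : 0 < k / (1 + eta) by rewrite divr_gt0.
apply: le_trans (_ : ((1 + eta) * k) `^ q / (k / (1 + eta)) `^ (q * d.+1%:R) <= _).
  apply: ler_pM; rewrite ?powR_ge0 ?invr_ge0 ?powR_ge0//.
    by rewrite ler_powR_base// addr_ge0// latnorm_ge0.
  have n1 : 0 < nrm x - 1 by lra.
  by rewrite lef_pV2 ?posrE ?powR_gt0// ler_powR_base ?(ltW ke0)// mulr_ge0.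
rewrite !powRM ?invr_ge0 ?(ltW k0) ?(ltW e1)//.
rewrite -[(1 + eta)^-1]powR_inv1 ?(ltW e1)// -powRrM mulN1r powRN invfM invrK.
have kE : k `^ (q * d.+1%:R) = k `^ q * k ^+ d.+1.
  rewrite -natr1 mulrDr mulr1 conj_exp_pred powRD; last by rewrite lt0r_neq0 ?implybT.
  by rewrite powR_mulrn ?(ltW k0)// mulrC.
rewrite kE invfM.
rewrite [leLHS](_ : _ = ((1 + eta) `^ q * (1 + eta) `^ (q * d.+1%:R)) * k ^- d.+1); last first.
  by field; rewrite expf_neq0 ?lt0r_neq0// powR_gt0.
rewrite ler_wpM2r ?invr_ge0 ?exprn_ge0 ?(ltW k0)//.
apply: le_trans etae; rewrite exprD -!powR_mulrn ?(ltW e1)//.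
have e1' : 1 <= 1 + eta by lra.
apply: ler_pM; rewrite ?powR_ge0//; apply: ler_powR => //; first exact: q_le2.
by rewrite natrM ler_wpM2r// q_le2.
Qed.

(** * The radial flow *)

(** The field x / |x|_q^(d+1) has the coordinates |u_i|^(p-2) u_i, where the
    u_i are the partial derivatives of u = log |x|_q and p = d + 1. It is
    divergence free in the continuum and is the dual object that certifies the
    lower bound. *)
Definition flow x i : R := (x ord0 i)%:~R / nrm x ^+ d.+1.

Lemma flowE x i : flow x i = (x ord0 i)%:~R / qpow x ^+ d.
Proof. by rewrite /flow latnorm_exprD. Qed.

(** The q-th powers of the flow are, up to discretisation, the energy density of
    [logpot]; this is the equality case of Young's inequality. *)
Lemma sum_flow_powR x : \sum_i `|flow x i| `^ q = if x == 0 then 0 else nrm x ^- d.+1.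
Proof.
case: eqVneq => [->|x0].
  by rewrite big1// => i _; rewrite /flow mxE mul0r normr0 powR0// gt1_neq0.
have n0 : 0 < nrm x by have := latnorm_ge1 x0; lra.
have nD0 : 0 <= nrm x ^- d.+1 by rewrite invr_ge0 exprn_ge0 ?(ltW n0).
rewrite (eq_bigr (fun i => `|(x ord0 i)%:~R| `^ q * (nrm x ^- d.+1) `^ q)); last first.
  by move=> i _; rewrite normrM powRM// (ger0_norm nD0).
rewrite -mulr_suml -/(qpow x) -latnorm_powR.
rewrite -powR_inv1 ?exprn_ge0 ?(ltW n0)// -powR_mulrn ?(ltW n0)// -!powRrM.
rewrite -powRD; last by rewrite lt0r_neq0 ?implybT.
congr (_ `^ _).
by rewrite -[in RHS]conj_exp_pred -natr1; ring.
Qed.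

Lemma sum_flow_near (e : R) : 0 < e -> exists m, forall x, (m <= lev x)%N ->
  \sum_i `|flow x i| `^ q <= (1 + e) * (lev x)%:R ^- d.+1.
Proof.
move=> e0; have [eta [eta0 eta1 etae]] := small_ratio d.+1 e0.
have [m hm] := level_near eta0; exists m.+1 => x xm.
have [x1 _ h1 _] := hm x (ltnW xm).
have k0 : 0 < (lev x)%:R :> R by rewrite ltr0n; lia.
have e1 : 0 < 1 + eta by lra.
rewrite sum_flow_powR; case: ifP => _.
  by rewrite mulr_ge0// ?invr_ge0 ?exprn_ge0//; lra.
apply: le_trans (_ : ((lev x)%:R / (1 + eta)) ^- d.+1 <= _).
  rewrite lef_pV2 ?posrE ?exprn_gt0 ?divr_gt0//; last lra.
  by rewrite lerXn2r ?nnegrE ?divr_ge0 ?latnorm_ge0 ?(ltW e1)//; lra.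
rewrite expr_div_n invfM invrK mulrC ler_wpM2r// invr_ge0 exprn_ge0//.
Qed.

Lemma flow_ge0 x i : 0 <= x ord0 i -> 0 <= flow x i.
Proof. by move=> h; rewrite divr_ge0 ?exprn_ge0 ?latnorm_ge0// ler0z. Qed.

Lemma flow_le0 x i : x ord0 i < 0 -> flow x i <= 0.
Proof.
move=> h; rewrite /flow -[X in X / _]opprK mulNr oppr_le0 divr_ge0 ?exprn_ge0 ?latnorm_ge0//.
by rewrite oppr_ge0 lerz0 ltW.
Qed.

(** The tangent inequality at the endpoint of smaller modulus bounds the
    increment of the potential from below; its sign is that of the coordinate,
    hence that of the flow. *)
Lemma flow_logpot_edge_ge x i : 1 < nrm x ->
  (Num.max (`|(x ord0 i)%:~R| - 1) 0) `^ q / (nrm x ^+ d.+1 * (nrm x + 1) `^ q)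
  <= flow x i * (logpot (x + e_ i) - logpot x).
Proof.
move=> x1; have n0 : 0 < nrm x by lra.
have q0 := ltW q_gt0.
have y0 : 0 < nrm (x + e_ i) by have := latnorm_adde_ge x i; lra.
have Sx0 : 0 < qpow x by rewrite -latnorm_powR powR_gt0.
have Sy0 : 0 < qpow (x + e_ i) by rewrite -latnorm_powR powR_gt0.
have Sx : qpow x <= (nrm x + 1) `^ q.
  by rewrite -latnorm_powR ler_powR_base ?(ltW n0)// lerDl.
have Sy : qpow (x + e_ i) <= (nrm x + 1) `^ q.
  by rewrite -latnorm_powR ler_powR_base ?(ltW y0)// latnorm_adde_le.
have N0 : 0 < (nrm x + 1) `^ q by rewrite powR_gt0; lra.
(* [b] and [b + 1] are the moduli of the coordinate at the two endpoints. *)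
have key (b u v : R) : 0 <= b -> 0 < u -> 0 < v -> v <= (nrm x + 1) `^ q ->
    v - u = (b + 1) `^ q - b `^ q ->
    b `^ (q - 1) / (nrm x + 1) `^ q <= q^-1 * ln v - q^-1 * ln u.
  move=> b0 u0 v0 vN uv; rewrite -mulrBr ler_pdivlMl ?q_gt0//.
  apply: le_trans (ln_subr_ge u0 v0); rewrite uv mulrA.
  have := powR_tangent q_gt1 b0 (addr_ge0 b0 ler01); rewrite addrAC subrr add0r mulr1 => h.
  apply: ler_pM; rewrite ?mulr_ge0 ?powR_ge0 ?invr_ge0 ?(ltW N0)//.
  by rewrite lef_pV2 ?posrE.
rewrite /flow invfM mulrA [X in X / _ <= _]mulrC.
have [xi|xi] := leP 0 (x ord0 i).
  set a : R := (x ord0 i)%:~R; have a0 : 0 <= a by rewrite ler0z.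
  have := key a (qpow x) (qpow (x + e_ i)) a0 Sx0 Sy0 Sy.
  rewrite qpow_adde rmorphD/= -/a !ger0_norm ?addr_ge0// => /(_ erefl).
  rewrite -!logpotE => h.
  rewrite [leRHS](_ : _ = nrm x ^- d.+1 * (a * (logpot (x + e_ i) - logpot x))); last by ring.
  rewrite -mulrA ler_wpM2l ?invr_ge0 ?exprn_ge0 ?(ltW n0)//.
  apply: le_trans (ler_wpM2l a0 h); rewrite mulrA ler_wpM2r ?invr_ge0 ?(ltW N0)//.
  rewrite mulr_powRB1 ?q_gt0//; apply: ler_powR_base => //; first by rewrite le_max lexx orbT.
  by rewrite ge_max a0 andbT; lra.
set b : R := - (x ord0 i)%:~R - 1.
have b0 : 0 <= b.
  by rewrite /b -rmorphN -[1]/(1%:~R) -rmorphB/= ler0z; lia.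
have xb : (x ord0 i)%:~R = - (b + 1) :> R by rewrite /b; ring.
have := key b (qpow (x + e_ i)) (qpow x) b0 Sy0 Sx0 Sx.
rewrite -[qpow x - _]opprB qpow_adde rmorphD/= xb normrN (ger0_norm (addr_ge0 b0 ler01)).
rewrite (_ : - (b + 1) + 1 = - b); last by ring.
rewrite normrN ger0_norm// opprB => /(_ erefl); rewrite -!logpotE => h.
rewrite addrK (max_idPl b0).
rewrite [leRHS](_ : _ = nrm x ^- d.+1 * ((b + 1) * (logpot x - logpot (x + e_ i))));
  last by ring.
rewrite -mulrA ler_wpM2l ?invr_ge0 ?exprn_ge0 ?(ltW n0)//.
have b1 : 0 <= b + 1 by rewrite addr_ge0.
apply: le_trans (ler_wpM2l b1 h); rewrite mulrA ler_wpM2r ?invr_ge0 ?(ltW N0)//.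
rewrite -mulr_powRB1 ?q_gt0// ler_wpM2r ?powR_ge0// lerDl//.
Qed.

Lemma sum_flow_logpot_ge x : 1 < nrm x -> d.+1%:R <= nrm x ->
  (nrm x - d.+1%:R) `^ q / (nrm x ^+ d.+1 * (nrm x + 1) `^ q)
  <= \sum_i flow x i * (logpot (x + e_ i) - logpot x).
Proof.
move=> x1 xd; have n0 : 0 < nrm x by lra.
apply: le_trans (ler_sum _ (fun i _ => flow_logpot_edge_ge i x1)).
rewrite -mulr_suml ler_wpM2r ?invr_ge0 ?mulr_ge0 ?exprn_ge0 ?powR_ge0 ?(ltW n0)//.
pose v i : R := Num.max (`|(x ord0 i)%:~R| - 1) 0.
have -> : \sum_i (Num.max (`|(x ord0 i)%:~R| - 1) 0) `^ q = lqnorm q v `^ q.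
  rewrite lqnorm_powR//; apply: eq_bigr => i _.
  by rewrite (ger0_norm (_ : 0 <= v i))// le_max lexx orbT.
apply: ler_powR_base; [exact/ltW/q_gt0|by rewrite subr_ge0|].
rewrite lerBlDr latnormE; apply: le_trans (_ : lqnorm q (fun i => v i + 1) <= _).
  apply: le_lqnorm => // i; rewrite [leRHS]ger0_norm.
    by rewrite -lerBlDr le_max lexx.
  by rewrite addr_ge0// le_max lexx orbT.
apply: le_trans (lqnormD q_gt1 _ _) _; rewrite lerD2l -[leRHS]mulr1.
by apply: lqnorm_le_card => // i; rewrite normr1.
Qed.

Lemma sum_flow_logpot_near (e : R) : 0 < e -> exists m, forall x, (m <= lev x)%N ->
  (1 - e) * (lev x)%:R ^- d.+1 <= \sum_i flow x i * (logpot (x + e_ i) - logpot x).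
Proof.
move=> e0; have [eta [eta0 eta1 etae]] := small_ratio 4 e0.
have [m hm] := level_near eta0; exists m.+1 => x xm.
have [x1 h1 _ h2] := hm x (ltnW xm).
have k0 : 0 < (lev x)%:R :> R by rewrite ltr0n; lia.
have e1 : 0 < 1 + eta by lra.
have q0 := ltW q_gt0.
have nk := latnorm_le_level q x.
set k := (lev x)%:R in k0 h1 h2 nk *.
have ke0 : 0 < k / (1 + eta) by rewrite divr_gt0.
have n0 : 0 < nrm x by lra.
apply: le_trans (sum_flow_logpot_ge x1 _); last lra.
apply: le_trans (_ : (k / (1 + eta)) `^ q / (k ^+ d.+1 * ((1 + eta) * k) `^ q) <= _);
  last first.
  have d1 : 1 <= d.+1%:R :> R by rewrite ler1n.
  apply: ler_pM; rewrite ?powR_ge0 ?invr_ge0 ?mulr_ge0 ?exprn_ge0 ?powR_ge0 ?(ltW k0)//.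
    by rewrite ler_powR_base// ltW.
  rewrite lef_pV2 ?posrE ?mulr_gt0 ?exprn_gt0 ?powR_gt0 ?mulr_gt0//; last lra.
  apply: ler_pM; rewrite ?exprn_ge0 ?powR_ge0 ?(ltW n0)//.
    by rewrite lerXn2r ?nnegrE ?(ltW n0) ?(ltW k0).
  by apply: ler_powR_base => //; lra.
rewrite !powRM ?invr_ge0 ?(ltW k0) ?(ltW e1)//.
rewrite -[(1 + eta)^-1]powR_inv1 ?(ltW e1)// -powRrM mulN1r powRN.
rewrite [leRHS](_ : _ = ((1 + eta) `^ q * (1 + eta) `^ q)^-1 * k ^- d.+1); last first.
  by field; rewrite expf_neq0 ?lt0r_neq0// powR_gt0.
rewrite ler_wpM2r ?invr_ge0 ?exprn_ge0 ?(ltW k0)//.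
apply: le_trans (_ : (1 + e)^-1 <= _).
  by rewrite -[leRHS]mul1r ler_pdivlMr; [nra|lra].
rewrite lef_pV2 ?posrE ?mulr_gt0 ?powR_gt0//; last lra.
apply: le_trans etae; rewrite (_ : 4%N = (2 + 2)%N)// exprD -!powR_mulrn ?(ltW e1)//.
have e1' : 1 <= 1 + eta by lra.
by apply: ler_pM; rewrite ?powR_ge0//; apply: ler_powR => //; exact: q_le2.
Qed.

(** * The divergence of the radial flow *)

(** For h(t) = t / (T + |t|^q)^d both the increment h(t) - h(t - 1) and the
    derivatives of h at t and t - 1 lie in one explicit interval (see also
    [flow_deriv_bounds]), so its length controls the discretisation error. It
    relies on q d = d + 1 and replaces a second-order expansion, since |t|^q is
    not twice differentiable at 0 when q < 2. *)
Lemma flow_step_bounds (T t : R) : 0 <= T -> 1 <= t ->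
  let Y := T + (t - 1) `^ q in let H := T + t `^ q in 0 < Y ->
  [/\ H ^- d - d.+1%:R * t `^ q * Y ^- d.+1 <= t / H ^+ d - (t - 1) / Y ^+ d,
      t / H ^+ d - (t - 1) / Y ^+ d <= Y ^- d - d.+1%:R * (t - 1) `^ q * H ^- d.+1,
      Y <= H & H - Y <= q * t `^ (q - 1)].
Proof.
move=> T0 t1 Y H Y0; have t0 : 0 <= t - 1 by lra.
have q0 := ltW q_gt0.
have YH : Y <= H by rewrite lerD2l; apply: ler_powR_base => //; lra.
have H0 : 0 < H by lra.
have HY : H - Y = t `^ q - (t - 1) `^ q by rewrite /H /Y; ring.
have t00 : 0 <= t by lra.
have du : H - Y <= q * t `^ (q - 1).
  have := powRB_le q_gt1 t0 t00; rewrite HY (_ : t - (t - 1) = 1) ?mulr1//; ring.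
have dl : q * (t - 1) `^ (q - 1) <= H - Y.
  have := powR_tangent q_gt1 t0 t00; rewrite HY (_ : t - (t - 1) = 1) ?mulr1//; ring.
have Xu := invXnB_le d.-1 Y0 YH; have Xl := invXnB_ge d.-1 Y0 YH.
rewrite prednK// in Xu Xl.
have -> : t / H ^+ d - (t - 1) / Y ^+ d = Y ^- d - t * (Y ^- d - H ^- d) by ring.
have Yi : 0 <= Y ^- d.+1 by rewrite invr_ge0 exprn_ge0 ?(ltW Y0).
have Hi : 0 <= H ^- d.+1 by rewrite invr_ge0 exprn_ge0 ?(ltW H0).
have tXu : t * (Y ^- d - H ^- d) <= d.+1%:R * t `^ q * Y ^- d.+1.
  apply: le_trans (ler_wpM2l t00 Xu) _; rewrite mulrA ler_wpM2r//.
  rewrite -conj_exp_pred -(mulr_powRB1 t00 q_gt0).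
  rewrite [leRHS](_ : _ = t * (d%:R * (q * t `^ (q - 1)))); last by ring.
  by rewrite ler_wpM2l// ler_wpM2l.
have tXl : d.+1%:R * (t - 1) `^ q * H ^- d.+1 <= t * (Y ^- d - H ^- d).
  apply: le_trans _ (ler_wpM2l t00 Xl); rewrite mulrA ler_wpM2r//.
  rewrite -conj_exp_pred -(mulr_powRB1 t0 q_gt0).
  rewrite [leLHS](_ : _ = (t - 1) * (d%:R * (q * (t - 1) `^ (q - 1)))); last by ring.
  apply: ler_pM; rewrite ?mulr_ge0 ?powR_ge0//; first lra.
  by rewrite ler_wpM2l.
have HYi : H ^- d <= Y ^- d by rewrite lef_pV2 ?posrE ?exprn_gt0// lerXn2r ?nnegrE// ltW.
split => //; last by rewrite lerD2l lerN2.
by apply: lerB.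
Qed.

(** One factor 1 / z is gained over the derivative of the flow itself, which
    makes the divergence summable over the lattice. The constants come from
    3^q <= 9 and q 3^(q-1) <= 6. *)
Lemma flow_step_width (T t z : R) : 0 <= T -> 1 <= t -> 1 <= z -> t <= 3 * z ->
  let Y := T + (t - 1) `^ q in let H := T + t `^ q in z `^ q <= Y ->
  (Y ^- d - d.+1%:R * (t - 1) `^ q * H ^- d.+1) -
  (H ^- d - d.+1%:R * t `^ q * Y ^- d.+1) <=
  6 * (d%:R + d.+1%:R + 9 * d.+1%:R ^+ 2) * z ^- d.+2.
Proof.
move=> T0 t1 z1 tz Y H zY; have z0 : 0 < z by lra.
have q0 := ltW q_gt0; have := q_gt1; have := q_le2 => q2 q1.
have Z0 : 0 < z `^ q by rewrite powR_gt0.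
have Y0 : 0 < Y by exact: lt_le_trans zY.
have [_ _] := flow_step_bounds T0 t1 Y0; rewrite -/H -/Y => YH du.
have Xu := invXnB_le d.-1 Y0 YH; have Xu' := invXnB_le d Y0 YH.
rewrite prednK// in Xu.
have HY : t `^ q = (t - 1) `^ q + (H - Y) by rewrite /H /Y; ring.
set Z := z `^ q in Z0 zY *.
have t00 : 0 <= t - 1 by lra.
have le3 p : p <= 2 -> (3 : R) `^ p <= 9.
  move=> p2; have -> : (9 : R) = 3 `^ 2%:R by rewrite powR_mulrn// expr2 -natrM.
  by apply: ler_powR => //; rewrite (ler_nat R 1).
have a9 : (t - 1) `^ q <= 9 * Z.
  apply: le_trans (ler_powR_base (b := 3 * z) _ _ _) _ => //; first lra.
  by rewrite powRM ?(ltW z0)// ler_wpM2r ?powR_ge0// le3.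
have d6 : H - Y <= 6 * z `^ (q - 1).
  apply: le_trans du _; apply: le_trans (_ : 2 * (3 * z `^ (q - 1)) <= _); last by lra.
  apply: ler_pM; rewrite ?powR_ge0//.
  apply: le_trans (ler_powR_base (b := 3 * z) _ _ _) _ => //; [lra|lra|].
  rewrite powRM ?(ltW z0)// ler_wpM2r ?powR_ge0//.
  apply: le_trans (_ : 3 `^ 1 <= _); last by rewrite powRr1.
  by apply: ler_powR; [rewrite (ler_nat R 1)|lra].
have Yk k : Y ^- k <= Z ^- k.
  by rewrite lef_pV2 ?posrE ?exprn_gt0// lerXn2r ?nnegrE ?(ltW Z0) ?(ltW Y0).
have Yk0 k : 0 <= Y ^- k by rewrite invr_ge0 exprn_ge0 ?(ltW Y0).
have del0 : 0 <= H - Y by rewrite subr_ge0.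
have e1 : (H - Y) * Y ^- d.+1 <= 6 * z ^- d.+2.
  apply: le_trans (_ : 6 * z `^ (q - 1) * Z ^- d.+1 <= _); first exact: ler_pM.
  rewrite -mulrA ler_wpM2l// le_eqVlt; apply/orP; left; apply/eqP.
  rewrite -!powR_invn ?powR_ge0 ?(ltW z0)// /Z -powRrM -powRD;
    last by rewrite lt0r_neq0 ?implybT.
  congr (_ `^ _); rewrite -[d.+2%:R]natr1 -[in RHS]conj_exp_pred -[d.+1%:R]natr1; ring.
have e2 : (t - 1) `^ q * (H - Y) * Y ^- d.+2 <= 9 * (6 * z ^- d.+2).
  have -> : Y ^- d.+2 = Y ^- d.+1 * Y^-1 by rewrite exprSr invfM.
  rewrite [leLHS](_ : _ = ((t - 1) `^ q / Y) * ((H - Y) * Y ^- d.+1)); last by ring.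
  apply: ler_pM => //.
  - by rewrite divr_ge0 ?powR_ge0 ?(ltW Y0).
  - by rewrite mulr_ge0.
  by rewrite ler_pdivrMr//; apply: le_trans a9 _; rewrite ler_wpM2l.
rewrite [leLHS](_ : _ = (Y ^- d - H ^- d) + d.+1%:R * ((H - Y) * Y ^- d.+1) +
    d.+1%:R * ((t - 1) `^ q * (Y ^- d.+1 - H ^- d.+1))); last by rewrite HY; ring.
rewrite [leRHS](_ : _ = d%:R * (6 * z ^- d.+2) + d.+1%:R * (6 * z ^- d.+2) +
    d.+1%:R * (d.+1%:R * (9 * (6 * z ^- d.+2)))); last by ring.
apply: lerD; first apply: lerD.
- by apply: le_trans Xu _; rewrite -mulrA ler_wpM2l.
- by rewrite ler_wpM2l.
rewrite ler_wpM2l//; apply: le_trans (ler_wpM2l (powR_ge0 _ _) Xu') _.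
rewrite [leLHS](_ : _ = d.+1%:R * ((t - 1) `^ q * (H - Y) * Y ^- d.+2)); last by ring.
by rewrite ler_wpM2l.
Qed.

Definition divergence x : R := \sum_i (flow x i - flow (x - e_ i) i).

(** The derivative of t / (T + |t|^q)^d with respect to t, at the i-th
    coordinate of x. *)
Definition flow_deriv x i : R :=
  qpow x ^- d - d.+1%:R * `|(x ord0 i)%:~R| `^ q * qpow x ^- d.+1.

(** The continuum flow is divergence free. *)
Lemma sum_flow_deriv x : x != 0 -> \sum_i flow_deriv x i = 0.
Proof.
move=> x0; have S0 : qpow x != 0.
  by rewrite -latnorm_powR lt0r_neq0// powR_gt0//; have := latnorm_ge1 x0; lra.
rewrite sumrB sumr_const card_ord -mulr_suml -mulr_sumr -/(qpow x) exprS invfM.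
by rewrite -[_ *+ _]mulr_natl mulrA mulfK// subrr.
Qed.

Lemma between_dist (lo hi D G w : R) : lo <= D -> D <= hi -> lo <= G -> G <= hi ->
  hi - lo <= w -> `|D - G| <= w.
Proof. by move=> *; rewrite ler_norml; apply/andP; split; lra. Qed.

Lemma flow_deriv_bounds (Y H s a b c : R) : 0 < Y -> Y <= s -> s <= H ->
  0 <= a -> a <= c -> c <= b ->
  H ^- d - d.+1%:R * b * Y ^- d.+1 <= s ^- d - d.+1%:R * c * s ^- d.+1 /\
  s ^- d - d.+1%:R * c * s ^- d.+1 <= Y ^- d - d.+1%:R * a * H ^- d.+1.
Proof.
move=> Y0 Ys sH a0 ac cb; have s0 := lt_le_trans Y0 Ys; have H0 := lt_le_trans s0 sH.
have V k (u v : R) : 0 < u -> u <= v -> v ^- k <= u ^- k.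
  move=> u0 uv; have v0 := lt_le_trans u0 uv.
  by rewrite lef_pV2 ?posrE ?exprn_gt0// lerXn2r ?nnegrE// ltW.
have I k (u : R) : 0 < u -> 0 <= u ^- k by move=> u0; rewrite invr_ge0 exprn_ge0// ltW.
have c0 := le_trans a0 ac.
split; apply: lerB; rewrite ?V//; apply: ler_pM; rewrite ?mulr_ge0 ?I ?V ?ler_wpM2l//.
Qed.

Lemma flow_step_deriv x i : 2 <= nrm x ->
  `|flow x i - flow (x - e_ i) i - flow_deriv x i| <=
  6 * (d%:R + d.+1%:R + 9 * d.+1%:R ^+ 2) * (nrm x - 1) ^- d.+2.
Proof.
move=> x2; set c := x ord0 i.
have q0 := ltW q_gt0.
have z1 : 1 <= nrm x - 1 by lra.
have ye : (x - e_ i) ord0 i = c - 1 by rewrite !mxE !eqxx.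
pose T := qpow x - `|c%:~R| `^ q.
have T0 : 0 <= T by rewrite subr_ge0 /qpow (bigD1 i)//= lerDl sumr_ge0// => j _;
  exact: powR_ge0.
have Sx : qpow x = T + `|c%:~R| `^ q by rewrite subrK.
have Sy : qpow (x - e_ i) = T + `|(c - 1)%:~R| `^ q.
  have := qpow_adde (x - e_ i) i; rewrite subrK ye subrK Sx; lra.
have Nx : (nrm x - 1) `^ q <= qpow x.
  by rewrite -latnorm_powR; apply: ler_powR_base => //; lra.
have Ny : (nrm x - 1) `^ q <= qpow (x - e_ i).
  by rewrite -latnorm_powR; apply: ler_powR_base => //; [lra|exact: latnorm_sube_ge].
have cx : `|c%:~R| <= nrm x by rewrite -intr_norm; exact: coord_le_latnorm.
have Z0 : 0 < (nrm x - 1) `^ q by rewrite powR_gt0//; lra.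
have ps (t : R) : 1 <= t -> (t - 1) `^ q <= t `^ q.
  by move=> t1; apply: ler_powR_base => //; lra.
rewrite !flowE ye -/c /flow_deriv -/c.
have [cp|cn] := leP 1 c.
  have c1 : 1 <= c%:~R :> R by rewrite -[1]/(1%:~R) ler_int.
  have cE : `|c%:~R| = c%:~R :> R by rewrite ger0_norm//; lra.
  have c'E : `|(c - 1)%:~R| = c%:~R - 1 :> R by rewrite rmorphB/= ger0_norm//; lra.
  rewrite cE in Sx cx *; rewrite c'E in Sy.
  rewrite (_ : (c - 1)%:~R = c%:~R - 1); last by rewrite rmorphB.
  rewrite Sy in Ny *; rewrite Sx.
  have tz : c%:~R <= 3 * (nrm x - 1) by move: cx x2; move: (nrm x) => n; lra.
  have Y0 := lt_le_trans Z0 Ny.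
  have [h1 h2 h3 _] := flow_step_bounds T0 c1 Y0.
  have h4 := flow_step_width T0 c1 z1 tz Ny.
  have [h5 h6] := flow_deriv_bounds Y0 h3 (lexx _) (powR_ge0 _ _) (ps _ c1) (lexx _).
  exact: between_dist h1 h2 h5 h6 h4.
have c0 : c%:~R <= 0 :> R by rewrite -[0]/(0%:~R) ler_int; lia.
have cE : `|c%:~R| = (1 - c%:~R) - 1 :> R by rewrite ler0_norm//; ring.
have c'E : `|(c - 1)%:~R| = 1 - c%:~R :> R by rewrite rmorphB/= ler0_norm ?opprB//; lra.
set t : R := 1 - c%:~R in cE c'E.
have t1 : 1 <= t by rewrite /t; lra.
rewrite cE in Sx cx *; rewrite c'E in Sy.
rewrite (_ : (c - 1)%:~R = - t); last by rewrite rmorphB/= /t opprB.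
rewrite (_ : c%:~R = - (t - 1)); last by rewrite /t; ring.
rewrite Sx in Nx *; rewrite Sy.
have tz : t <= 3 * (nrm x - 1) by move: cx x2; move: (nrm x) => n; lra.
have Y0 := lt_le_trans Z0 Nx.
have [h1 h2 h3 _] := flow_step_bounds T0 t1 Y0.
have h4 := flow_step_width T0 t1 z1 tz Nx.
have [h5 h6] := flow_deriv_bounds Y0 (lexx _) h3 (powR_ge0 _ _) (lexx _) (ps _ t1).
rewrite (_ : - (t - 1) / _ - - t / _ = t / (T + t `^ q) ^+ d - (t - 1) / (T + (t - 1) `^ q)
  ^+ d); last by ring.
exact: between_dist h1 h2 h5 h6 h4.
Qed.

Lemma divergence_near : exists2 C : R, 0 <= C & exists m, forall x, (m <= lev x)%N ->
  `|divergence x| <= C * (lev x)%:R ^- d.+2.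
Proof.
pose W : R := 6 * (d%:R + d.+1%:R + 9 * d.+1%:R ^+ 2).
have W0 : 0 <= W by rewrite mulr_ge0// !addr_ge0// mulr_ge0// exprn_ge0.
exists (d.+1%:R * (W * 2 ^+ d.+2)); first by rewrite mulr_ge0// mulr_ge0// exprn_ge0.
exists 4%N => x x4.
have k4 : 4 <= (lev x)%:R :> R by rewrite (ler_nat R 4).
have n2 : 2 <= nrm x by have := level_lt q x; move: (nrm x) => n; lra.
have x0 : x != 0.
  by rewrite -latnorm_eq0; apply: lt0r_neq0; move: n2; move: (nrm x) => n; lra.
have nk : (lev x)%:R / 2 <= nrm x - 1 by have := level_lt q x; move: (nrm x) => n; lra.
have -> : divergence x = \sum_i (flow x i - flow (x - e_ i) i - flow_deriv x i).
  by rewrite sumrB sum_flow_deriv// subr0.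
apply: le_trans (ler_norm_sum _ _ _) _.
apply: le_trans (_ : \sum_(i < d.+1) (W * 2 ^+ d.+2) * (lev x)%:R ^- d.+2 <= _); last first.
  by rewrite sumr_const card_ord -[_ *+ _]mulr_natl mulrA.
apply: ler_sum => i _; apply: le_trans (flow_step_deriv i n2) _.
rewrite -/W -mulrA ler_wpM2l//.
apply: le_trans (_ : ((lev x)%:R / 2) ^- d.+2 <= _).
  rewrite lef_pV2 ?posrE ?exprn_gt0//; [|by move: n2; move: (nrm x) => n; lra|by lra].
  by rewrite lerXn2r ?nnegrE//; move: n2 nk; move: (nrm x) => n; lra.
by rewrite expr_div_n invfM invrK mulrC.
Qed.

End Edges.

(** * Sums over the edges of a box *)

Section Box.
Variables (R : realType) (d : nat).
Hypothesis d0 : (0 < d)%N.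
Local Notation q := (conj_exp R d.+1).
Local Notation pt := 'rV[int]_d.+1.
Local Notation nrm x := (@latnorm R d.+1 q x).
Local Notation e_ i := (delta_mx ord0 i : pt).
Local Notation lev x := (@level R d q x).
Local Notation L n := (fset_set (latball q n%:R : set pt)).
Local Notation B n := (fset_set (box n : set pt)).
Local Notation V := (@qball_vol R d.+1 q).
Local Notation s := (d.+1%:R * V).
Implicit Types (x y : pt) (i j : 'I_d.+1) (f g : pt -> R) (G : pt -> 'I_d.+1 -> R).

Let q1 : 1 < q. Proof. exact: q_gt1. Qed.

Lemma mem_boxset n x : (x \in B n) = (supnorm x <= n)%N.
Proof.
rewrite in_fset_set; last exact: finite_box.
by apply/idP/idP; rewrite inE.
Qed.

(** An edge is indexed by its lower endpoint and its direction. *)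
Definition edge_sum n G : R :=
  \sum_(x <- B n) \sum_i (if (supnorm (x + e_ i) <= n)%N then G x i else 0).

Lemma energyE (p : R) n f :
  energy p n f = edge_sum n (fun x i => `|f x - f (x + e_ i)| `^ p).
Proof.
rewrite /energy.
pose h (xi : pt * 'I_d.+1) : pt * pt := (xi.1, xi.1 + e_ xi.2).
pose Q : set (pt * 'I_d.+1) := box n `*` [set: 'I_d.+1].
pose J : set (pt * 'I_d.+1) := [set xi | box n (xi.1 + e_ xi.2)].
have -> : edges n = h @` (Q `&` J).
  apply/seteqP; split => [[x y] [/= bx byy [i yE]]|_ [[x i] [[/= bx _] bJ] <-]].
    by exists (x, i); rewrite /h/= -?yE//; split => //=; rewrite /J/= -yE.
  by split => //; exists i.
have fQ : finite_set Q by apply: finite_setX; [exact: finite_box|exact: finite_finset].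
rewrite fsbig_image/=; last first.
  move=> [x i] [y j] _ _ [-> /addrI/matrixP/(_ ord0 i)].
  by rewrite !mxE !eqxx/=; case: eqVneq => [->|].
rewrite fsbig_mkcondr.
transitivity (\sum_(x \in (box n : set pt)) \sum_(i \in [set: 'I_d.+1])
    (if (x, i) \in J then `|f x - f (x + e_ i)| `^ p else 0)).
  rewrite pair_fsbig; [|exact: finite_box|exact: finite_finset].
  by apply: eq_fsbigr => -[x i] _.
rewrite fsbig_finite/=; last exact: finite_box.
apply: eq_bigr => x _.
rewrite (fsbigE (index_enum 'I_d.+1))//=; [|exact: index_enum_uniq|by move=> i /=;
  rewrite mem_index_enum].
apply: eq_big => [i|i _]; first by rewrite in_setT.
by congr (if _ then _ else _); apply/idP/idP; rewrite /J inE.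
Qed.

Lemma ler_edge_sum n G G' :
  (forall x i, (supnorm x <= n)%N -> (supnorm (x + e_ i) <= n)%N -> G x i <= G' x i) ->
  edge_sum n G <= edge_sum n G'.
Proof.
move=> GG; rewrite /edge_sum big_seq [leRHS]big_seq; apply: ler_sum => x;
  rewrite mem_boxset => xn.
by apply: ler_sum => i _; case: ifP => // xi; exact: GG.
Qed.

Lemma edge_sum_ge0 n G : (forall x i, 0 <= G x i) -> 0 <= edge_sum n G.
Proof.
by move=> G0; apply: sumr_ge0 => x _; apply: sumr_ge0 => i _; case: ifP.
Qed.

Lemma edge_sumD n G G' : edge_sum n (fun x i => G x i + G' x i) = edge_sum n G + edge_sum n G'.
Proof.
rewrite /edge_sum -big_split/=; apply: eq_bigr => x _; rewrite -big_split/=.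
by apply: eq_bigr => i _; case: ifP; rewrite ?addr0.
Qed.

Lemma edge_sumZ n (c : R) G : edge_sum n (fun x i => c * G x i) = c * edge_sum n G.
Proof.
rewrite /edge_sum mulr_sumr; apply: eq_bigr => x _; rewrite mulr_sumr.
by apply: eq_bigr => i _; case: ifP; rewrite ?mulr0.
Qed.

Lemma le_edge_sum n G x i : (forall x i, 0 <= G x i) ->
  (supnorm x <= n)%N -> (supnorm (x + e_ i) <= n)%N -> G x i <= edge_sum n G.
Proof.
move=> G0 xn xin; rewrite /edge_sum (bigD1_seq x)/= ?mem_boxset ?fset_uniq//.
rewrite (bigD1 i)//= xin -addrA lerDl addr_ge0//.
  by apply: sumr_ge0 => j _; case: ifP.
by apply: sumr_ge0 => y _; apply: sumr_ge0 => j _; case: ifP.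
Qed.

Lemma box_sub_latball n : (box n : set pt) `<=` latball q (d.+1 * n)%:R.
Proof.
move=> x /= xn; rewrite /latball/=; apply: le_trans (latnorm_le_supnorm q1 x) _.
by rewrite natrM ler_wpM2l// ler_nat.
Qed.

Lemma latball_sub_box n : latball q n%:R `<=` (box n : set pt).
Proof.
by move=> x /= xn; rewrite /box/= -(ler_nat R); apply: le_trans (supnorm_le_latnorm q1 x) xn.
Qed.

Lemma edge_sum_le_latball n G : (forall x i, 0 <= G x i) ->
  edge_sum n G <= \sum_(x <- L (d.+1 * n)) \sum_i G x i.
Proof.
move=> G0; apply: le_trans (_ : \sum_(x <- B n) \sum_i G x i <= _).
  by apply: ler_sum => x _; apply: ler_sum => i _; case: ifP.
apply: le_fset_sum; [exact: finite_latball|exact: box_sub_latball|].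
by move=> x; exact: sumr_ge0.
Qed.

Lemma sum_boxset_shift n (v : pt) (H : pt -> R) :
  \sum_(x <- B n | (supnorm (x + v) <= n)%N) H (x + v) =
  \sum_(y <- B n | (supnorm (y - v) <= n)%N) H y.
Proof.
rewrite -big_filter -(big_map (fun x => x + v) xpredT H) -[RHS]big_filter.
apply: perm_big; apply: uniq_perm.
- rewrite map_inj_uniq; last exact: addIr.
  exact/filter_uniq/fset_uniq.
- exact/filter_uniq/fset_uniq.
move=> y; rewrite mem_filter mem_boxset; apply/mapP/andP => [[x]|[yn yv]].
  by rewrite mem_filter mem_boxset => /andP[xv xn] ->; rewrite addrK.
by exists (y - v); rewrite ?subrK// mem_filter mem_boxset subrK yn yv.
Qed.

Lemma coord_le_supnorm x i : (`|x ord0 i| <= supnorm x)%N.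
Proof. exact: (leq_bigmax i). Qed.

Lemma supnorm_leP x n : reflect (forall i, (`|x ord0 i| <= n)%N) (supnorm x <= n)%N.
Proof.
apply: (iffP idP) => [xn i|h]; first exact: leq_trans (coord_le_supnorm x i) xn.
by apply/bigmax_leqP.
Qed.

Lemma supnorm_adde x i : (supnorm (x + e_ i) <= (supnorm x).+1)%N.
Proof.
apply/supnorm_leP => j; rewrite addeE; have := coord_le_supnorm x j.
by move: (x ord0 j) => z; case: (j == i); lia.
Qed.

Lemma supnorm_sube x i : (supnorm (x - e_ i) <= (supnorm x).+1)%N.
Proof.
apply/supnorm_leP => j; rewrite !mxE eqxx/=; have := coord_le_supnorm x j.
by move: (x ord0 j) => z; case: (j == i); lia.
Qed.

(** An edge leaving the box starts on its boundary, where g vanishes; hence no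
    boundary term survives. *)
Lemma edge_sum_parts n g : (forall x, supnorm x = n -> g x = 0) ->
  edge_sum n (fun x i => @flow R d x i * (g (x + e_ i) - g x)) =
  - \sum_(x <- B n) g x * @divergence R d x.
Proof.
move=> gb.
have bd x v : (supnorm x <= n)%N -> ~~ (supnorm (x + v) <= n)%N ->
    (supnorm (x + v) <= (supnorm x).+1)%N -> g x = 0.
  by move=> h1 h2 h3; apply: gb; lia.
rewrite /edge_sum exchange_big/=.
transitivity (\sum_i (\sum_(x <- B n) (@flow R d (x - e_ i) i - @flow R d x i) * g x)).
  apply: eq_bigr => i _.
  transitivity (\sum_(x <- B n | (supnorm (x + e_ i) <= n)%N)
      @flow R d (x + e_ i - e_ i) i * g (x + e_ i) -
      \sum_(x <- B n | (supnorm (x + e_ i) <= n)%N) @flow R d x i * g x).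
    rewrite -sumrB [RHS]big_mkcond; apply: eq_bigr => x _.
    by case: ifP => // _; rewrite addrK mulrBr.
  rewrite (sum_boxset_shift n (e_ i) (fun y => @flow R d (y - e_ i) i * g y)).
  under [RHS]eq_bigr do rewrite mulrBl.
  rewrite sumrB; congr (_ - _); rewrite big_mkcond big_seq [RHS]big_seq;
    apply: eq_bigr => x; rewrite mem_boxset => xn; case: ifPn => // h.
    by rewrite (bd x (- e_ i))// ?mulr0// supnorm_sube.
  by rewrite (bd x (e_ i))// ?mulr0// supnorm_adde.
rewrite exchange_big/= -sumrN; apply: eq_bigr => x _.
rewrite -mulr_suml -mulrN mulrC; congr (_ * _).
by rewrite /divergence -sumrN; apply: eq_bigr => i _; rewrite opprB.
Qed.

(** Young's inequality, scaled so that equality holds when |a| is the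
    (q - 1)-st power of |th| divided by l, as it does for the increments of
    [logpot] divided by l. *)
Lemma young_edge (th a l : R) : 0 < l ->
  d.+1%:R * l ^- d * (th * a) - d%:R * l ^- d.+1 * `|th| `^ q <= `|a| `^ d.+1%:R.
Proof.
move=> l0; have q0 := @q_gt0 R d d0.
have ld : 0 < l ^- d by rewrite invr_gt0 exprn_gt0.
have D0 : 0 < d.+1%:R :> R by rewrite ltr0n.
have := conjugate_powR (normr_ge0 a) (mulr_ge0 (normr_ge0 th) (ltW ld)) D0 q0 (conj_expD R
  (d0 : (2 <= d.+1)%N)).
rewrite powRM ?(ltW ld)// => /(ler_wpM2l (ltW D0)).
have -> : (l ^- d) `^ q = l ^- d.+1.
  rewrite -powR_invn ?(ltW l0)// -powRrM -powR_invn ?(ltW l0)//; congr (_ `^ _).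
  by rewrite mulNr mulrC conj_exp_pred.
rewrite mulrDr [d.+1%:R * (`|a| `^ _ / _)]mulrC divfK ?lt0r_neq0//.
have -> : d.+1%:R * (`|th| `^ q * l ^- d.+1 / q) = d%:R * l ^- d.+1 * `|th| `^ q.
  have aux (u v D e : R) : v != 0 -> v * e = D -> D * (u / v) = e * u.
    by move=> v0 <-; field.
  by rewrite (aux _ _ _ d%:R)// ?lt0r_neq0// ?conj_exp_pred// -mulrA [_ * l ^- _]mulrC.
rewrite lerBlDr; apply: le_trans.
rewrite -mulrA ler_wpM2l// [leRHS](_ : _ = l ^- d * (`|th| * `|a|)); last by ring.
by rewrite ler_wpM2l ?(ltW ld)// -normrM ler_norm.
Qed.

(** A lattice path inside the box leads from x to the origin by moving one
    coordinate towards 0 at each step. *)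
Lemma path_bound n f (del : R) : f 0 = 0 ->
  (forall x i, (supnorm x <= n)%N -> (supnorm (x + e_ i) <= n)%N ->
     `|f x - f (x + e_ i)| <= del) ->
  forall x, (supnorm x <= n)%N -> `|f x| <= (d.+1 * supnorm x)%:R * del.
Proof.
move=> f0 fd x xn.
have del0 : 0 <= del \/ supnorm x = 0%N.
  have [->|x0] := eqVneq (supnorm x) 0%N; [by right|left].
  apply: le_trans (fd 0 ord0 _ _); first exact: normr_ge0.
    by apply/supnorm_leP => i; rewrite mxE.
  by apply/supnorm_leP => i; rewrite add0r mxE eqxx; case: (i == ord0) => //=; lia.
suff h k y : (\sum_i `|y ord0 i|)%N = k -> (supnorm y <= n)%N -> `|f y| <= k%:R * del.
  apply: le_trans (h _ x erefl xn) _.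
  have le1 : (\sum_i `|x ord0 i| <= d.+1 * supnorm x)%N.
    rewrite -[X in (_ <= X * _)%N]card_ord -sum_nat_const.
    by apply: leq_sum => i _; exact: coord_le_supnorm.
  case: del0 => [del0|x0]; first by rewrite ler_wpM2r// ler_nat.
  by move: le1; rewrite x0 muln0 leqn0 => /eqP ->.
elim: k y => [|k IH] y yk yn.
  have -> : y = 0.
    apply/rowP => i; rewrite mxE; move/eqP: yk; rewrite sum_nat_eq0.
    by move=> /forallP/(_ i)/=; rewrite absz_eq0 => /eqP.
  by rewrite f0 normr0 mul0r.
have [i yi] : exists i, y ord0 i != 0.
  apply/existsP; apply: contraT; rewrite negb_exists => /forallP h.
  by move: yk; rewrite big1// => i _; have := h i; rewrite negbK => /eqP ->.
have step (z : pt) : (forall j, j != i -> z ord0 j = y ord0 j) ->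
    (`|z ord0 i|.+1 = `|y ord0 i|)%N ->
    (\sum_i `|z ord0 i|)%N = k /\ (supnorm z <= n)%N.
  move=> zj zi; split.
    rewrite (bigD1 i)//=; move: yk; rewrite (bigD1 i)//= -zi addSn => -[<-]; congr addn.
    by apply: eq_bigr => j ji; rewrite zj.
  apply/supnorm_leP => j; have /supnorm_leP yn' := yn.
  have [->|/zj ->] := eqVneq j i; last exact: yn'.
  by apply: leq_trans (yn' i); rewrite -zi.
have dk : k.+1%:R * del = k%:R * del + del by rewrite -natr1 mulrDl mul1r.
have [yp|yneg] := leP 0 (y ord0 i).
  have [||zk zn] := step (y - e_ i).
  - by move=> j ji; rewrite !mxE eqxx/= (negbTE ji) subr0.
  - by rewrite !mxE !eqxx/=; move: (y ord0 i) yi yp => z; lia.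
  have h1 := IH _ zk zn; have := fd (y - e_ i) i zn; rewrite subrK => /(_ yn) h2.
  rewrite dk -[f y](subrK (f (y - e_ i))) addrC; apply: le_trans (ler_normD _ _) _.
  by apply: lerD => //; rewrite distrC.
have [||zk zn] := step (y + e_ i).
- by move=> j ji; rewrite !mxE eqxx/= (negbTE ji) addr0.
- by rewrite !mxE !eqxx/=; move: (y ord0 i) yi yneg => z; lia.
have h1 := IH _ zk zn; have h2 := fd y i yn zn.
rewrite dk -[f y](subrK (f (y + e_ i))) addrC; apply: le_trans (ler_normD _ _) _.
by apply: lerD.
Qed.

Definition clamp01 (a : R) : R := if 1 <= a then 1 else if 0 <= a then a else 0.

Lemma clamp01_itv a : 0 <= clamp01 a <= 1.
Proof. by rewrite /clamp01; case: (leP 1 a) => h; [|case: (leP 0 a) => h']; lra. Qed.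

Lemma clamp01_lip a b : `|clamp01 a - clamp01 b| <= `|a - b|.
Proof.
have := ler_norm (a - b); have := ler_norm (- (a - b)); rewrite normrN => h1 h2.
rewrite ler_norml /clamp01; apply/andP; split;
 by case: (leP 1 a) => ?; case: (leP 1 b) => ?; case: (leP 0 a) => ?; case: (leP 0 b) => ?; lra.
Qed.

(** * The upper bound *)

Lemma admissible_logpot n : (2 <= n)%N ->
  admissible n (fun x => (ln n%:R : R)^-1 * @logpot R d x).
Proof.
move=> n2; have n1 : 1 < n%:R :> R by rewrite ltr1n.
have L0 : 0 < ln n%:R :> R by exact: ln_gt0.
split; first by rewrite logpot0// mulr0.
move=> x /= xn; rewrite ler_pdivlMl// mulr1.
rewrite /logpot; have := supnorm_le_latnorm q1 x; rewrite xn => h.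
by rewrite ler_ln// posrE; [exact: lt_trans n1|apply: lt_le_trans h; exact: lt_trans n1].
Qed.

Lemma energy_ge0 (p : R) n f : 0 <= energy p n f.
Proof. by rewrite energyE edge_sum_ge0// => x i; exact: powR_ge0. Qed.

Lemma Cap_le (p : R) n f : admissible n f -> Cap d.+1 p n <= energy p n f.
Proof.
move=> af; apply: ge_inf; last by exists f.
by exists 0 => _ [g _ <-]; exact: energy_ge0.
Qed.

Lemma Cap_ge (p c : R) n : (2 <= n)%N ->
  (forall f, admissible n f -> c <= energy p n f) -> c <= Cap d.+1 p n.
Proof.
move=> n2 h; apply: lb_le_inf; last by move=> _ [f af <-]; exact: h.
by exists (energy p n (fun x => (ln n%:R : R)^-1 * @logpot R d x));
  exists (fun x => (ln n%:R : R)^-1 * @logpot R d x) => //; exact: admissible_logpot.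
Qed.

Lemma Cap_upper (e : R) : 0 < e -> exists M, forall n, (2 <= n)%N ->
  Cap d.+1 (d.+1%:R : R) n <= ((1 + e) * s * ln n%:R + M) / ln n%:R ^+ d.+1.
Proof.
move=> e0.
have [M hM] := sum_latball_log_le q1 (sum_logpot_edge_near d0) e0.
exists ((1 + e) * s * ln d.+1%:R + M) => n n2.
have n1 : 1 < n%:R :> R by rewrite ltr1n.
have L0 : 0 < ln n%:R :> R by exact: ln_gt0.
apply: le_trans (Cap_le _ (admissible_logpot n2)) _.
rewrite energyE; set l := ln n%:R in L0 *.
rewrite (_ : (fun x i => _) = (fun x i => l ^- d.+1 * `|@logpot R d x - @logpot R d (x + e_
  i)| `^ d.+1%:R)); last first.
  apply/funext => x; apply/funext => i; rewrite -mulrBr normrM powRM//.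
  by rewrite (gtr0_norm (_ : 0 < l^-1)) ?invr_gt0// powR_mulrn ?invr_ge0 ?(ltW L0)// exprVn.
rewrite edge_sumZ mulrC ler_wpM2r ?invr_ge0 ?exprn_ge0 ?(ltW L0)//.
apply: le_trans (edge_sum_le_latball _ _) _; first by move=> *; exact: powR_ge0.
apply: le_trans (hM _ _) _; first by rewrite muln_gt0/=; lia.
rewrite natrM lnM ?posrE ?ltr0n//; last by lia.
by rewrite mulrDr -/l; lra.
Qed.

End Box.

(** * The lower bound *)

Lemma ln_nat_large (R : realType) (A : R) : exists N, (2 <= N)%N /\ forall n, (N <= n)%N ->
  A <= ln (n%:R : R).
Proof.
have p := expR_ge0 A.
exists (Num.bound (expR A)).+2; split => // n hn.
have n0 : 0 < n%:R :> R by rewrite ltr0n; lia.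
rewrite -ler_expR lnK ?posrE//; apply/ltW/(lt_le_trans (archi_boundP p)).
by rewrite ler_nat; lia.
Qed.

Lemma ln_pred_ge (R : realType) n : (2 <= n)%N -> ln (n%:R : R) - 1 <= ln (n.-1%:R : R).
Proof.
move=> n2; have n0 : 0 < n%:R :> R by rewrite ltr0n; lia.
have m0 : 0 < n.-1%:R :> R by rewrite ltr0n; lia.
have := ln_subr_le m0 n0; have -> : n%:R - n.-1%:R = 1 :> R.
  by rewrite -{1}(@prednK n) -?natr1; [ring|lia].
have : 1 / n.-1%:R <= 1 :> R by rewrite ler_pdivrMr// mul1r ler1n; lia.
lra.
Qed.

Lemma flux_arith (R : realType) (e s M l l' : R) : 0 <= s -> l - 1 <= l' -> l' <= l ->
  `|1 - e| * s + M <= l * e -> l * (s - (s + 1) * e) <= (1 - e) * s * l' - M.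
Proof.
move=> s0 h1 h2; have [e1|e1] := leP 0 (1 - e).
  rewrite ger0_norm// => h; have := ler_wpM2l (mulr_ge0 e1 s0) h1; nra.
rewrite ltr0_norm// => h.
have e1' : (1 - e) * s <= 0 by rewrite mulr_le0_ge0 ?(ltW e1).
have := ler_wnM2l e1' h2; have : 0 <= - (1 - e) * s by rewrite mulNr oppr_ge0.
nra.
Qed.

Section Lower.
Variables (R : realType) (d : nat).
Hypothesis d0 : (0 < d)%N.
Local Notation q := (conj_exp R d.+1).
Local Notation pt := 'rV[int]_d.+1.
Local Notation nrm x := (@latnorm R d.+1 q x).
Local Notation e_ i := (delta_mx ord0 i : pt).
Local Notation lev x := (@level R d q x).
Local Notation L n := (fset_set (latball q n%:R : set pt)).
Local Notation B n := (fset_set (box n : set pt)).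
Local Notation V := (@qball_vol R d.+1 q).
Local Notation s := (d.+1%:R * V).
Local Notation fl := (@flow R d).
Local Notation lp := (@logpot R d).
Implicit Types (x y : pt) (i j : 'I_d.+1) (f g : pt -> R).

Let q1 : 1 < q. Proof. exact: q_gt1. Qed.

Lemma supnorm_le_level x : (supnorm x <= lev x)%N.
Proof.
rewrite -(ler_nat R); apply: le_trans (supnorm_le_latnorm q1 x) _.
exact: latnorm_le_level.
Qed.

(** Truncation at 1 makes the profile agree on the boundary of the box with a
    potential clamped to [0, 1]. *)
Definition profile (l : R) x : R := Num.min 1 (l^-1 * lp x).

Lemma profile_itv l x : 0 < l -> 0 <= profile l x <= 1.
Proof.
move=> l0; rewrite /profile le_min ler01 ge_min lexx/= andbT.
by rewrite mulr_ge0 ?invr_ge0 ?(ltW l0) ?logpot_ge0.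
Qed.

Lemma profile_mono l x y : 0 < l -> nrm x <= nrm y -> profile l x <= profile l y.
Proof.
move=> l0 xy; rewrite /profile le_min ge_min lexx/= ge_min.
by apply/orP; right; rewrite ler_pM2l ?invr_gt0// logpot_mono.
Qed.

(** The flow points away from the origin and the profile increases in that
    direction. *)
Lemma flow_profile_ge0 l x i : 0 < l -> 0 <= fl x i * (profile l (x + e_ i) - profile l x).
Proof.
move=> l0; have [h1 h2] := latnorm_adde_mono R d0 x i.
have [xi|xi] := leP 0 (x ord0 i).
  by rewrite mulr_ge0 ?flow_ge0// subr_ge0 profile_mono// h1.
by rewrite mulr_le0 ?flow_le0// subr_le0 profile_mono// h2.
Qed.

Lemma profileE n x : (2 <= n)%N -> nrm x <= n%:R -> profile (ln n%:R) x = (ln n%:R)^-1 * lp x.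
Proof.
move=> n2 xn; have n1 : 1 < n%:R :> R by rewrite ltr1n.
have l0 := ln_gt0 n1; apply/min_idPr; rewrite ler_pdivrMl// mulr1.
have [->|x0] := eqVneq x 0; first by rewrite logpot0// ltW.
have := latnorm_ge1 R d0 x0 => h; rewrite /logpot ler_ln ?posrE//; first exact: lt_le_trans h.
exact: lt_trans n1.
Qed.

Lemma profile_boundary n x : (2 <= n)%N -> supnorm x = n -> profile (ln n%:R) x = 1.
Proof.
move=> n2 xn; have n1 : 1 < n%:R :> R by rewrite ltr1n.
have l0 := ln_gt0 n1; apply/min_idPl; rewrite ler_pdivlMl// mulr1.
have := supnorm_le_latnorm q1 x; rewrite xn => h.
by rewrite /logpot ler_ln// posrE; [exact: lt_trans n1|apply: lt_le_trans h;
  exact: lt_trans n1].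
Qed.

(** By [flow_profile_ge0], the edges on which the truncation is active can be
    discarded. *)
Lemma edge_sum_flow_profile_ge n : (2 <= n)%N ->
  (ln n%:R)^-1 * \sum_(x <- L n.-1) \sum_i fl x i * (lp (x + e_ i) - lp x) <=
  edge_sum n (fun x i => fl x i * (profile (ln n%:R) (x + e_ i) - profile (ln n%:R) x)).
Proof.
move=> n2; have n1 : 1 < n%:R :> R by rewrite ltr1n.
have l0 := ln_gt0 n1; set l := ln n%:R in l0 *.
have sub : (latball q n.-1%:R : set pt) `<=` box n.
  move=> x /= xn; apply: (@latball_sub_box _ _ d0 n x) => /=.
  by apply: le_trans xn _; rewrite ler_nat leq_pred.
rewrite (fset_sum_sub _ (finite_box _ _) sub) mulr_sumr big_mkcond/= /edge_sum.
rewrite [leLHS]big_seq [leRHS]big_seq; apply: ler_sum => x xB; case: ifPn => [|_]; last first.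
  by apply: sumr_ge0 => i _; case: ifP => // _; exact: flow_profile_ge0.
rewrite inE /latball/= => xn; rewrite mulr_sumr; apply: ler_sum => i _.
have nn : n.-1%:R + 1 = n%:R :> R by rewrite natr1 prednK//; lia.
have yn : nrm (x + e_ i) <= n%:R.
  by apply: le_trans (latnorm_adde_le R d0 x i) _; rewrite -nn lerD2r.
have yB : (supnorm (x + e_ i) <= n)%N by exact: (@latball_sub_box _ _ d0 n _ yn).
rewrite yB !profileE//; last by apply: le_trans xn _; rewrite ler_nat leq_pred.
by rewrite -mulrBr mulrCA.
Qed.

Lemma energy_clamp n f : energy d.+1%:R n (fun x => clamp01 (f x)) <= energy d.+1%:R n f.
Proof.
rewrite !energyE//; apply: ler_edge_sum => // x i _ _.
by apply: ler_powR_base => //; exact: clamp01_lip.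
Qed.

Lemma admissible_clamp n f : admissible n f -> admissible n (fun x => clamp01 (f x)).
Proof.
case=> f0 fb; split; first by rewrite f0 /clamp01 lexx leNgt ltr01.
by move=> x /fb h; rewrite /clamp01 h.
Qed.

(** Weak duality: [young_edge] summed over the edges of the box. *)
Lemma energy_ge_flow n f l : 0 < l ->
  d.+1%:R * l ^- d * edge_sum n (fun x i => fl x i * (f (x + e_ i) - f x)) -
  d%:R * l ^- d.+1 * edge_sum n (fun x i => `|fl x i| `^ q) <= energy d.+1%:R n f.
Proof.
move=> l0; rewrite energyE// -!edge_sumZ// -mulN1r -edge_sumZ// -edge_sumD//.
apply: ler_edge_sum => // x i _ _; rewrite distrC mulN1r.
exact: young_edge.
Qed.

Lemma divergence_tail (e : R) : 0 < e -> exists m, (0 < m)%N /\ forall n,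
  \sum_(x <- B n | (m < lev x)%N) `|@divergence R d x| <= e.
Proof.
move=> e0; have [C C0 [m hm]] := @divergence_near R d d0.
have [C' C'0 hC'] := @level_tail_sum R d q q1.
have p : 0 <= C * C' / e by rewrite divr_ge0 ?mulr_ge0// ltW.
pose k := Num.bound (C * C' / e).
exists (m + k).+1; split => // n.
apply: le_trans (_ : \sum_(x <- L (d.+1 * n) | ((m + k).+1 < lev x)%N) `|@divergence R d x|
  <= _).
  rewrite big_mkcond/= [leRHS]big_mkcond/=; apply: le_fset_sum;
    [exact: finite_latball|exact: box_sub_latball|].
  by move=> x; case: ifP.
apply: le_trans (_ : \sum_(x <- L (d.+1 * n) | ((m + k).+1 < lev x)%N) C * (lev x)%:R ^- d.+2
  <= _).
  by apply: ler_sum => x xm; apply: hm; lia.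
rewrite -mulr_sumr; apply: le_trans (ler_wpM2l C0 (hC' _ _ _)) _ => //.
rewrite mulrA ler_pdivrMr ?ltr0n// [e * _]mulrC -ler_pdivrMr//.
apply/ltW/(lt_le_trans (archi_boundP p)); rewrite ler_nat -/k; lia.
Qed.

(** By [energy_ge_flow] it suffices that the flow pairs with the gradient of f
    to nearly s, the flux of the flow through a large sphere. This pairing is
    exact up to s e for the profile, so the difference g of f and the profile
    must be shown to pair to nearly 0. After summation by parts g is integrated
    against the divergence: far from the origin the divergence is summable and
    |g| <= 1, and near the origin g is small, because an energy below
    s / (ln n)^d forces small increments on every edge. *)
Lemma energy_lower (e : R) : 0 < e -> exists N, (2 <= N)%N /\ forall n, (N <= n)%N ->
  forall f, admissible n f ->
  (s - (d.+1%:R * (s + 3) + d%:R * (s + 1)) * e) / ln n%:R ^+ d <= energy d.+1%:R n f.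
Proof.
move=> e0; have V0 : 0 < V by exact: qball_vol_gt0.
have s0 : 0 < s by rewrite mulr_gt0.
have [M1 hM1] := sum_latball_log_le q1 (sum_flow_near d0) e0.
have [M2 hM2] := sum_latball_log_ge q1 (sum_flow_logpot_near d0) e0.
have [m [m0 hm]] := divergence_tail e0.
pose K : R := \sum_(x <- L m) `|@divergence R d x|.
have K0 : 0 <= K by apply: sumr_ge0.
have K1 : 0 < K + 1 by exact: ltr_wpDl K0 ltr01.
pose eta := e / (K + 1).
have eta0 : 0 < eta by rewrite divr_gt0.
have etaK : eta * K <= e by rewrite /eta mulrAC (ler_pdivrMr _ _ K1) ler_wpM2l ?(ltW e0)//
  lerDl.
(* A path from a point of level at most m to 0 has at most (d + 1) m edges. *)
pose del := eta / 2 / (d.+1 * m)%:R.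
have Dm0 : 0 < (d.+1 * m)%:R :> R by rewrite ltr0n muln_gt0.
have del0 : 0 < del by rewrite /del divr_gt0// divr_gt0.
have [N [N2 hN]] := ln_nat_large (Num.max 1 (Num.max (ln m%:R / (eta / 2))
  (Num.max (s / del ^+ d.+1) (Num.max ((`|1 - e| * s + M2) / e)
    (((1 + e) * s * ln d.+1%:R + M1) / e))))).
exists (N + m)%N; split; first exact: leq_trans N2 (leq_addr _ _).
move=> n nN f0 af0.
have mn : (m <= n)%N := leq_trans (leq_addl N m) nN.
have n2 : (2 <= n)%N := leq_trans N2 (leq_trans (leq_addr m N) nN).
have n1 : 1 < n%:R :> R by rewrite ltr1n.
have := hN n (leq_trans (leq_addr m N) nN); rewrite !ge_max.
set l := ln n%:R => /and5P[l1 hN2 hN3 hN4 hN5].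
have l0 : 0 < l := lt_le_trans ltr01 l1.
have ld0 : 0 < l ^- d by rewrite invr_gt0 exprn_gt0.
pose f x := clamp01 (f0 x).
have [f_0 f_bd] : admissible n f by exact: admissible_clamp.
apply: le_trans (energy_clamp n f0); rewrite -/f.
(* A potential of larger energy satisfies the claim trivially. *)
have [Ebig|Esmall] := leP (s / l ^+ d) (energy d.+1%:R n f).
  apply: le_trans Ebig; rewrite ler_pM2r// lerBlDr lerDl.
  by rewrite !mulr_ge0 ?(ltW e0)// addr_ge0// mulr_ge0// addr_ge0// ltW.
have f01 x : 0 <= f x <= 1 by exact: clamp01_itv.
have edge x i : (supnorm x <= n)%N -> (supnorm (x + e_ i) <= n)%N ->
  `|f x - f (x + e_ i)| <= del.
  move=> xn xin; have := @le_edge_sum R d n (fun x i => `|f x - f (x + e_ i)| `^ d.+1%:R) x i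
    (fun _ _ => powR_ge0 _ _) xn xin.
  rewrite -energyE// => h.
  have {}h : `|f x - f (x + e_ i)| ^+ d.+1 <= del ^+ d.+1.
    move: h; rewrite powR_mulrn// => h; apply: le_trans h _; apply: le_trans (ltW Esmall) _.
    rewrite ler_pdivrMr ?exprn_gt0// [del ^+ _ * _]mulrC -ler_pdivrMr ?exprn_gt0//.
    by apply: le_trans hN3 _; apply: ler_eXnr => //.
  by rewrite -(@ler_pXn2r _ d.+1)// nnegrE// ltW.
pose g x := f x - profile l x.
have g1 x : `|g x| <= 1.
  have := f01 x; have := profile_itv x l0; rewrite /g ler_norml; lra.
have gb x : supnorm x = n -> g x = 0.
  move=> xn; rewrite /g profile_boundary//; have := f_bd x xn; have := f01 x; lra.
have gm x : (lev x <= m)%N -> `|g x| <= eta.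
  move=> xm; have xm' : (supnorm x <= m)%N by exact: leq_trans (supnorm_le_level x) xm.
  have := @path_bound R d d0 n f del f_0 edge x (leq_trans xm' mn) => h.
  have h2 : `|f x| <= eta / 2.
    apply: le_trans h _; apply: le_trans (_ : (d.+1 * m)%:R * del <= _).
      by rewrite ler_wpM2r ?(ltW del0)// ler_nat leq_mul2l xm'.
    by rewrite /del mulrC divfK// lt0r_neq0.
  have h3 : profile l x <= eta / 2.
    apply: le_trans (_ : l^-1 * lp x <= _); first by rewrite /profile ge_min lexx orbT.
    rewrite ler_pdivrMl// -ler_pdivrMr ?divr_gt0//.
    apply: le_trans hN2; rewrite ler_pM2r ?invr_gt0 ?divr_gt0//.
    have [->|x0] := eqVneq x 0; first by rewrite logpot0// ln_ge0// ler1n.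
    have x1 := latnorm_ge1 R d0 x0; rewrite /logpot ler_ln ?posrE ?ltr0n//;
      first by rewrite -level_le.
    exact: lt_le_trans x1.
  move: h2; rewrite /g !ler_norml; have := profile_itv x l0; have := f01 x; lra.
pose A := edge_sum n (fun x i => fl x i * (g (x + e_ i) - g x)).
have hA : - (2 * e) <= A.
  rewrite /A edge_sum_parts// lerN2.
  apply: le_trans (ler_norm _) _; apply: le_trans (ler_norm_sum _ _ _) _.
  rewrite (bigID (fun x => (lev x <= m)%N))/=.
  apply: le_trans (_ : e + e <= _); last lra.
  apply: lerD; last first.
    rewrite (eq_bigl (fun x => (m < lev x)%N)); last by move=> y; rewrite ltnNge.
    apply: le_trans (hm n); apply: ler_sum => x _.
    by rewrite normrM ler_piMl.
  apply: le_trans etaK.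
  apply: le_trans (_ : \sum_(x <- B n | (lev x <= m)%N) eta * `|@divergence R d x| <= _).
    by apply: ler_sum => x xm; rewrite normrM ler_wpM2r// gm.
  rewrite -mulr_sumr ler_pM2l//.
  apply: le_trans (_ : \sum_(x <- L (d.+1 * n) | (lev x <= m)%N) `|@divergence R d x| <= _).
    rewrite big_mkcond/= [leRHS]big_mkcond/=; apply: le_fset_sum;
      [exact: finite_latball|exact: box_sub_latball|].
    by move=> x; case: ifP.
  exact: sum_levels_low.
pose F := edge_sum n (fun x i => fl x i * (profile l (x + e_ i) - profile l x)).
have hF : s - (s + 1) * e <= F.
  apply: le_trans (edge_sum_flow_profile_ge n2); rewrite -/l ler_pdivlMl//.
  apply: le_trans (hM2 n.-1 _); last by rewrite -ltnS prednK// ltnW.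
  have lp1 := @ln_pred_ge R n n2; rewrite -/l in lp1.
  have lp2 : ln n.-1%:R <= l.
    by rewrite ler_ln ?posrE ?ltr0n ?ler_nat ?leq_pred// ?(ltnW n2)// -ltnS prednK// ltnW.
  by apply: flux_arith => //; [exact: ltW|rewrite -ler_pdivrMr].
have hAF : edge_sum n (fun x i => fl x i * (f (x + e_ i) - f x)) = A + F.
  rewrite /A /F -edge_sumD//; congr edge_sum; apply/funext => x; apply/funext => i.
  by rewrite /g; ring.
have hS : edge_sum n (fun x i => `|fl x i| `^ q) <= (s + (s + 1) * e) * l.
  apply: le_trans (edge_sum_le_latball d0 _ _) _; first by move=> *; exact: powR_ge0.
  apply: le_trans (hM1 _ _) _; first by rewrite muln_gt0/= ltnW.
  rewrite natrM lnM ?posrE ?ltr0n ?(ltnW n2)// -/l.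
  rewrite [leRHS](_ : _ = (1 + e) * s * l + l * e); last by ring.
  by rewrite mulrDr addrAC addrC lerD2l -ler_pdivrMr.
apply: le_trans (energy_ge_flow n f l0).
rewrite hAF [leLHS]mulrC.
apply: le_trans (_ : d.+1%:R * l ^- d * (s - (s + 3) * e) - d%:R * l ^- d * (s + (s + 1) * e)
  <= _).
  by rewrite -natr1 le_eqVlt; apply/orP; left; apply/eqP; ring.
apply: lerB.
  by rewrite ler_wpM2l ?mulr_ge0 ?(ltW ld0)//; lra.
rewrite -!mulrA !ler_wpM2l//; rewrite exprSr invfM -mulrA ler_wpM2l ?(ltW ld0)//.
by rewrite ler_pdivrMl// mulrC.
Qed.

End Lower.

(** * Asymptotics *)

(** The volume s of the unit sphere is d + 1 times the volume of the unit ball;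
    [Cap_upper] and [energy_lower] differ by lower-order terms. *)
Lemma Cap_asymp (R : realType) (d : nat) : (0 < d)%N ->
  forall e : R, 0 < e -> exists N, forall n, (N <= n)%N ->
  `|1 - Cap d.+1 (d.+1%:R : R) n /
     (d.+1%:R * qball_vol d.+1 (conj_exp R d.+1) / ln (n%:R : R) ^+ d)| <= e.
Proof.
move=> d0 e e0; set V := qball_vol _ _.
have V0 : 0 < V by apply: qball_vol_gt0 => //; exact: q_gt1.
set s := d.+1%:R * V; have s0 : 0 < s by rewrite mulr_gt0.
have e20 : 0 < e / 2 by rewrite divr_gt0.
have [M hM] := Cap_upper d0 e20.
pose K := d.+1%:R * (s + 3) + d%:R * (s + 1).
have K0 : 0 < K by rewrite ltr_pwDl ?mulr_ge0 ?mulr_gt0 ?addr_gt0// ltW// addr_gt0.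
have [N1 [N12 hN1]] := @energy_lower R d d0 (e * s / K) (divr_gt0 (mulr_gt0 e0 s0) K0).
have [N2 [N22 hN2]] := ln_nat_large (M / (e / 2 * s)).
exists (N1 + N2)%N => n nN.
have n2 : (2 <= n)%N := leq_trans N12 (leq_trans (leq_addr _ _) nN).
have l0 : 0 < ln (n%:R : R) by rewrite ln_gt0// ltr1n.
have up := hM n n2.
have lo := Cap_ge d0 n2 (hN1 n (leq_trans (leq_addr _ _) nN)).
have ml := hN2 n (leq_trans (leq_addl _ _) nN).
rewrite -/V -/s in up; rewrite -/V -/s -/K in lo.
move: (Cap _ _ _) (ln _) l0 up lo ml => c l l0 up lo ml.
have ld0 : 0 < l ^+ d by rewrite exprn_gt0.
rewrite invf_div mulrA distrC ler_norml; apply/andP; split.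
  rewrite lerBrDl ler_pdivlMr// -ler_pdivrMr//; apply: le_trans _ lo.
  rewrite ler_pM2r ?invr_gt0// [K * _]mulrC divfK ?lt0r_neq0//.
  by rewrite mulrBl mul1r.
rewrite lerBlDr ler_pdivrMr// -ler_pdivlMr//; apply: le_trans up _.
rewrite ler_pdivrMr ?exprn_gt0// [leRHS](_ : _ = (e + 1) * s * l); last first.
  by rewrite exprS; field; rewrite lt0r_neq0.
rewrite ler_pdivrMr ?mulr_gt0// in ml.
have -> : (e + 1) * s * l = (1 + e / 2) * s * l + l * (e / 2 * s) by field.
by rewrite lerD2l.
Qed.

Theorem theorem1p2 (R : realType) (d : nat) (hd : (2 <= d)%N) :
  let q : R := d%:R / (d%:R - 1) in
  asymp_equiv (fun n : nat => Cap d (d%:R : R) n)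
    (fun n : nat => surface_volume q (qsphere d q) / (ln (n%:R : R)) ^+ (d - 1)).
Proof.
case: d hd => [//|d] hd q.
have -> : surface_volume q (qsphere d.+1 q) = d.+1%:R * qball_vol d.+1 q.
  by apply: surface_volume_qsphere; exact: (conj_exp_gt1 R hd).
rewrite subn1 /asymp_equiv; apply/cvgrPdist_le => e e0.
have [N hN] := @Cap_asymp R d hd e e0.
by exists N => // n /= Nn; exact: hN.
Qed.
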